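(* The limit $a(2,4)$ does not exist. More precisely, for every $\kappa\in[0,4]$ there exists a sequence $(\mathcal{H}_n)_{n\in\mathbb{N}}$ in $B(2,4)$ such that $[\mathbb{Q}(\mathcal{H}_n^4):\mathbb{Q}]=2$ for all $n$, $\lim_{n\to\infty}\mathcal{H}_n=\infty$, and \[ \lim_{n\to\infty}\frac{\log|A(2,4,\mathcal{H}_n)|}{\log\mathcal{H}_n}=\kappa. \]
   Context: For algebraic $\alpha$ of degree $d$, with $a_0>0$ the leading coefficient of a minimal polynomial of $\alpha$ in $\mathbb{Z}[t]$ and conjugates $\alpha_1,\dots,\alpha_d$, $H(\alpha)=\big(a_0\prod_i\max\{1,|\alpha_i|\}\big)^{1/d}$ (absolute multiplicative Weil height). $A(k,d,\mathcal{H})=\{\alpha\in\mathbb{C}: [\mathbb{Q}(\alpha):\mathbb{Q}]=d,\ H(\alpha)=\mathcal{H},$ precisely $k$ conjugates of $\alpha$ in the open unit disk$\}$; $A(k,d)=\bigcup_{\mathcal{H}\ge1}A(k,d,\mathcal{H})$; $B(k,d)=\{H(\alpha):\alpha\in A(k,d)\}$; $a(k,d)=\lim_{\mathcal{H}\in B(k,d),\mathcal{H}\to\infty}\log|A(k,d,\mathcal{H})|/\log\mathcal{H}$ when it exists. *)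

(* Defs.v *)
From HB Require Import structures.
From mathcomp Require Import all_boot all_order all_algebra complex.
From mathcomp Require Import all_classical all_reals all_analysis.
Set Implicit Arguments.
Unset Strict Implicit.
Unset Printing Implicit Defensive.
Import Order.TTheory GRing.Theory Num.Theory.
Local Open Scope ring_scope.
Local Open Scope classical_set_scope.

Section Heights.
Variable R : realType.
Local Notation C := (complex R).

Definition cabs (z : C) : R := complex.Re `|z|.

Definition polyZC (p : {poly int}) : {poly C} := map_poly (fun z : int => z%:~R) p.

(* p is "the" minimal polynomial of a in Z[t]: p(a) = 0, p irreducible over Q,
   and p primitive with positive leading coefficient (zcontents p = 1). *)
Definition minpolyZ (a : C) (p : {poly int}) : Prop :=
  root (polyZC p) a /\
  irreducible_poly (map_poly (fun z : int => z%:~R : rat) p) /\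
  zcontents p = 1.

Definition alg_degree (a : C) (d : nat) : Prop :=
  exists p : {poly int}, minpolyZ a p /\ size p = d.+1.

Definition conjugates_of (a : C) (p : {poly int}) (rs : seq C) : Prop :=
  minpolyZ a p /\
  polyZC p = (lead_coef p)%:~R *: \prod_(r <- rs) ('X - r%:P).

Definition Aset (k d : nat) (h : R) : set C :=
  [set a | exists (p : {poly int}) (rs : seq C),
     conjugates_of a p rs /\ size rs = d /\
     count (fun r => cabs r < 1) rs = k /\
     h = powR ((lead_coef p)%:~R * \prod_(r <- rs) Num.max 1 (cabs r))
              (d%:R)^-1].

Definition Bset (k d : nat) : set R :=
  [set h | exists a : C, Aset k d h a].

End Heights.

(* Main.v *)
(** Fix an odd prime q, put s = sqrt (2q), b = 2^i, and let a be an odd integer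
    with |a - b s| < 1 and prime to 2 q b^2.  The height is h^(1/4) with
    h = a + b s, a real quadratic integer whose conjugate h' = a - b s is less
    than 1 in absolute value.

    If alpha has this height and exactly two conjugates in the unit disk, with
    minimal polynomial f of leading coefficient a0, then the two outer conjugates
    have product eps h / a0 with eps = 1 or -1, so f factors over Q(s) as
    a0 (t^2 - v/a0 t + eps h/a0) (t^2 - v'/a0 t + eps h'/a0) with v = (x + y s)/2 and
    x, y integers.  Here a0 divides hh', |y| = O(b), x lies in an interval of
    length O(a0), and a0 | x a - 2 q y b fixes x modulo a0 because a is prime to
    hh'.  So there are O(b d(|hh'|)) such alpha, and d(|hh'|) = h^o(1).

    Conversely, for odd y < b and the odd x nearest to y s, the polynomial
    (t^2 - (x + y s) t + eps h) (t^2 - (x - y s) t + eps h') with eps h' > 0 is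
    congruent to t^4 + 2 t^3 + t^2 + 2 t + 1 modulo 4, which makes it irreducible,
    and it has two roots on each side of the unit circle.  So there are at least
    b/2 such alpha.

    As h is about 2 b s and b, s are free, log b / log h can be made to tend to
    any number in [0, 1]. *)
Require Import Defs.
From HB Require Import structures.
From mathcomp Require Import all_boot all_order all_algebra complex.
From mathcomp Require Import all_classical all_reals all_analysis.
From mathcomp Require Import zify ring lra.
Import Order.TTheory GRing.Theory Num.Theory.
Import numFieldNormedType.Exports.
Local Open Scope ring_scope.
Local Open Scope classical_set_scope.
Set Implicit Arguments.
Unset Strict Implicit.
Unset Printing Implicit Defensive.

(** * The divisor bound [d(n) = n^o(1)] *)

(** With [m] the quotient of [e] by [k], one has [e + 1 <= k (m + 1) <= k 2^m], and
    [2^(m k) <= 2^e]. *)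
Lemma succ_exp_le (k e : nat) : (0 < k)%N -> (e.+1 ^ k <= k ^ k * 2 ^ e)%N.
Proof.
move=> k_gt0; set m := (e %/ k)%N.
have em : (e.+1 <= k * m.+1)%N by rewrite mulnC; exact: ltn_ceil.
apply: (@leq_trans ((k * m.+1) ^ k)); first by rewrite leq_exp2r.
rewrite expnMn leq_mul2l; apply/orP; right.
apply: (@leq_trans ((2 ^ m) ^ k)); first by rewrite leq_exp2r // ltn_expl.
by rewrite -expnM leq_exp2l // leq_trunc_div.
Qed.

Lemma size_divisorsE (n : nat) :
  size (divisors n) = (\prod_(p <- primes n) (logn p n).+1)%N.
Proof.
rewrite -(big_map (fun p => (p, logn p n)) xpredT (fun f => f.2.+1)) -prime_decompE.
rewrite /divisors; elim: (prime_decomp n) => [|[p e] s IH]; rewrite ?big_nil//.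
rewrite big_cons /= -IH; elim: e => [|e IHe] /=; first by rewrite mul1n.
by rewrite size_merge size_cat size_map IHe [RHS]mulSn addnC.
Qed.

(** Compare the factors [(e + 1)^k] and [p^e] prime by prime. For [p >= 2^k] no constant is lost,
    since [(e + 1)^k <= 2^(k e) <= p^e]. Each of the fewer than [2^k] smaller primes costs a factor
    [k^k]. *)
Lemma size_divisors_exp_le (k : nat) : (0 < k)%N ->
  exists C : nat, (0 < C)%N /\
    forall n : nat, (0 < n)%N -> (size (divisors n) ^ k <= C * n)%N.
Proof.
move=> k_gt0; set M := (k ^ k)%N; set B := (2 ^ k)%N.
have M_gt0 : (0 < M)%N by rewrite expn_gt0 k_gt0.
exists (M ^ B)%N; split; first by rewrite expn_gt0 M_gt0.
move=> n n_gt0; rewrite size_divisorsE.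
have -> : ((\prod_(p <- primes n) (logn p n).+1) ^ k =
           \prod_(p <- primes n) (logn p n).+1 ^ k)%N.
  by apply: (big_morph (expn^~ k)) => [x y|]; rewrite ?expnMn ?exp1n.
apply: (@leq_trans (\prod_(p <- primes n) ((if p < B then M else 1) * p ^ logn p n))%N).
  rewrite big_seq [leqRHS]big_seq; apply: leq_prod => p.
  rewrite mem_primes => /and3P[p_pr _ _].
  case: ltnP => [pB|Bp].
    apply: leq_trans (succ_exp_le _ k_gt0) _; rewrite leq_mul2l; apply/orP; right.
    by have [->|lp] := posnP (logn p n); rewrite ?expn0// leq_exp2r // prime_gt1.
  rewrite mul1n; apply: (@leq_trans (B ^ logn p n)).
    by rewrite /B -expnM mulnC expnM leq_exp2r// ltn_expl.
  by have [->|lp] := posnP (logn p n); rewrite ?expn0// leq_exp2r.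
rewrite big_split /=; apply: leq_mul; last first.
  by rewrite [leqRHS](prod_prime_decomp n_gt0) prime_decompE big_map.
rewrite -big_mkcond /= big_const_seq iter_muln_1 leq_pexp2l//.
rewrite -size_filter -[leqRHS](size_iota 0); apply: uniq_leq_size.
  by rewrite filter_uniq // primes_uniq.
by move=> p; rewrite mem_filter mem_iota /= => /andP[].
Qed.

(** * An irreducibility criterion modulo 4 for integer quartics *)

Lemma int_even_or_odd (x : int) : exists k : int, x = 2 * k \/ x = 2 * k + 1.
Proof.
exists (x %/ 2)%Z; have := modz_ge0 x (isT : (2 : int) != 0).
have := ltz_pmod x (isT : (0 : int) < 2); have := divz_eq x 2; lia.
Qed.

(** Modulo 2 the product is [t^4 + t^2 + 1], which has no root in the field with two elements. *)
Lemma coefs_quartic_linear_factor (g0 g1 r0 r1 r2 r3 k0 k1 k2 k3 : int) :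
  g0 * r0 = 2 * k0 + 1 -> g0 * r1 + g1 * r0 = 2 * k1 ->
  g0 * r2 + g1 * r1 = 2 * k2 + 1 -> g0 * r3 + g1 * r2 = 2 * k3 ->
  g1 * r3 = 1 -> False.
Proof.
case: (int_even_or_odd g0) => a [] ->; case: (int_even_or_odd g1) => b [] ->;
case: (int_even_or_odd r0) => c [] ->; case: (int_even_or_odd r1) => d [] ->;
case: (int_even_or_odd r2) => e [] ->; case: (int_even_or_odd r3) => f [] ->; lia.
Qed.

(** Modulo 2 the product is [(t^2 + t + 1)^2], so all four coefficients are odd. Modulo 4,
    [g0 * r0 = 1] gives [g0 + r0 = 2], and [g1 + r1 = 2] gives [g1 * r1 = 1]; the middle coefficient
    is then 3, not 1. *)
Lemma coefs_quartic_quadratic_factor_monic (g0 g1 r0 r1 k0 k1 k2 k3 : int) :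
  g0 * r0 = 4 * k0 + 1 -> g0 * r1 + g1 * r0 = 2 * k1 ->
  g0 + g1 * r1 + r0 = 4 * k2 + 1 -> g1 + r1 = 4 * k3 + 2 -> False.
Proof.
case: (int_even_or_odd g0) => a [] ->; case: (int_even_or_odd r0) => c [] ->;
  try lia.
case: (int_even_or_odd g1) => b [] ->; case: (int_even_or_odd r1) => d [] ->;
  try lia.
move=> e0 _ e2 e3; have {}e0 : 2 * (a * c) + a + c = 2 * k0 by lia.
have {}e2 : 4 * (b * d) + 2 * (a + c + b + d) + 2 = 4 * k2 by lia.
by move: (a * c) (b * d) e0 e2 e3 => ac bd; lia.
Qed.

Lemma coefs_quartic_quadratic_factor (g0 g1 g2 r0 r1 r2 k0 k1 k2 k3 : int) :
  g0 * r0 = 4 * k0 + 1 -> g0 * r1 + g1 * r0 = 2 * k1 ->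
  g0 * r2 + g1 * r1 + g2 * r0 = 4 * k2 + 1 -> g1 * r2 + g2 * r1 = 4 * k3 + 2 ->
  g2 * r2 = 1 -> False.
Proof.
move=> e0 e1 e2 e3 e4.
have [[g2E r2E]|[g2E r2E]] : g2 = 1 /\ r2 = 1 \/ g2 = -1 /\ r2 = -1.
- have : (`|g2| * `|r2|)%N = 1%N by rewrite -abszM e4.
  by move/eqP; rewrite muln_eq1 => /andP[/eqP ? /eqP ?]; lia.
- apply: (coefs_quartic_quadratic_factor_monic e0 e1 (k2 := k2) (k3 := k3)); lia.
- apply: (@coefs_quartic_quadratic_factor_monic (- g0) (- g1) (- r0) (- r1)
    k0 k1 k2 k3); lia.
Qed.

Lemma size_quartic_factors (m n : nat) :
  (0 < m -> 0 < n -> 5 = (m + n).-1 -> m != 1 ->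
   m = 2 /\ n = 4 \/ m = 3 /\ n = 3 \/ m = 4 /\ n = 2 \/ m = 5)%N.
Proof. by move=> m_gt0 n_gt0 mn /eqP; lia. Qed.

Lemma irreducible_quartic_mod4 (p : {poly int}) (k0 k1 k2 k3 : int) :
  size p = 5%N -> p`_4 = 1 -> p`_3 = 4 * k3 + 2 -> p`_2 = 4 * k2 + 1 ->
  p`_1 = 2 * k1 -> p`_0 = 4 * k0 + 1 ->
  irreducible_poly (map_poly (fun z : int => z%:~R : rat) p).
Proof.
move=> sp p4 p3 p2 p1 p0; apply/irreducible_rat_int; split; first by rewrite sp.
move=> q q1 qp; rewrite -dvdp_size_eqp // sp.
(* Gauss's lemma: the primitive part of a rational divisor divides [p] over the integers. *)
have [r pE] := dvdpP_int qp.
move: (size_zprimitive q) pE; move: (zprimitive q) => g gq pE.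
rewrite -gq; have {q1 gq} g1 : size g != 1%N by rewrite gq.
have p_neq0 : p != 0 by rewrite -size_poly_gt0 sp.
have g_neq0 : g != 0 by apply: contraNneq p_neq0 => g0; rewrite pE g0 mul0r.
have r_neq0 : r != 0 by apply: contraNneq p_neq0 => r0; rewrite pE r0 mulr0.
have := size_mul g_neq0 r_neq0; rewrite -pE sp => sgr.
have g_gt0 : (0 < size g)%N by rewrite size_poly_gt0.
have r_gt0 : (0 < size r)%N by rewrite size_poly_gt0.
have gs i : (size g <= i)%N -> g`_i = 0 by move=> ?; rewrite nth_default.
have rs i : (size r <= i)%N -> r`_i = 0 by move=> ?; rewrite nth_default.
have cE i : p`_i = \sum_(j < i.+1) g`_j * r`_(i - j) by rewrite pE coefM.
have e0 : g`_0 * r`_0 = 4 * k0 + 1 by rewrite -p0 cE big_ord1.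
have e1 : g`_0 * r`_1 + g`_1 * r`_0 = 2 * k1.
  by rewrite -p1 cE !big_ord_recr big_ord0 /= add0r.
have e2 : g`_0 * r`_2 + g`_1 * r`_1 + g`_2 * r`_0 = 4 * k2 + 1.
  by rewrite -p2 cE !big_ord_recr big_ord0 /= add0r.
have e3 : g`_0 * r`_3 + g`_1 * r`_2 + g`_2 * r`_1 + g`_3 * r`_0 = 4 * k3 + 2.
  by rewrite -p3 cE !big_ord_recr big_ord0 /= add0r.
have e4 : g`_0 * r`_4 + g`_1 * r`_3 + g`_2 * r`_2 + g`_3 * r`_1 + g`_4 * r`_0 = 1.
  by rewrite -p4 cE !big_ord_recr big_ord0 /= add0r.
have [[sg sr]|[[sg sr]|[[sg sr]|->//]]] : size g = 2%N /\ size r = 4%N \/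
  size g = 3%N /\ size r = 3%N \/ size g = 4%N /\ size r = 2%N \/ size g = 5%N.
- exact: size_quartic_factors g_gt0 r_gt0 sgr g1.
- rewrite !(gs 2, gs 3, gs 4, rs 4) ?(sg, sr) // in e0 e1 e2 e3 e4.
  (* A linear factor is excluded by parity alone, so the congruences modulo 4 are weakened to
     congruences modulo 2. *)
  by exfalso; apply: (@coefs_quartic_linear_factor g`_0 g`_1 r`_0 r`_1 r`_2 r`_3
    (2 * k0) k1 (2 * k2) (2 * k3 + 1)); lia.
- rewrite !(gs 3, gs 4, rs 3, rs 4) ?(sg, sr) // in e0 e1 e2 e3 e4.
  by exfalso; apply: (@coefs_quartic_quadratic_factor g`_0 g`_1 g`_2 r`_0 r`_1 r`_2
    k0 k1 k2 k3); lia.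
- rewrite !(gs 4, rs 2, rs 3, rs 4) ?(sg, sr) // in e0 e1 e2 e3 e4.
  by exfalso; apply: (@coefs_quartic_linear_factor r`_0 r`_1 g`_0 g`_1 g`_2 g`_3
    (2 * k0) k1 (2 * k2) (2 * k3 + 1)); lia.
Qed.

(** * Arithmetic of [2q] and of its square root [s] *)

(** For [y > 0] the valuation at [q] is even on the left and, as [q] is not 2, odd on the right. *)
Lemma sqr_eq_2prime_sqr (q x y : nat) :
  prime q -> odd q -> (x ^ 2 = 2 * q * y ^ 2)%N -> y = 0%N.
Proof.
move=> q_pr q_odd e; apply/eqP; rewrite -leqn0 leqNgt; apply/negP => y_gt0.
have q_gt0 := prime_gt0 q_pr.
have x_gt0 : (0 < x)%N by rewrite lt0n; apply/eqP => x0; move: e; rewrite x0; nia.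
have := congr1 (logn q) e.
rewrite lognX lognM ?expn_gt0 ?y_gt0 ?muln_gt0 ?q_gt0// lognX lognM //.
rewrite (logn_prime q q_pr) eqxx.
have -> : logn q 2 = 0%N.
  by rewrite lognE q_pr /= (dvdn_prime2 q_pr (isT : prime 2)); case: eqP q_odd => // ->.
lia.
Qed.

Lemma dvd_sqr_2prime (q v : nat) :
  prime q -> odd q -> (v ^ 2 %| 2 * q)%N -> v = 1%N.
Proof.
move=> q_pr q_odd dv; apply/eqP; apply: contraT => v1.
have q_gt0 := prime_gt0 q_pr.
have Dgt0 : (0 < 2 * q)%N by rewrite muln_gt0 q_gt0.
have v_gt0 : (0 < v)%N.
  by rewrite lt0n; apply/eqP => v0; move: dv; rewrite v0 dvd0n; lia.
have l_pr : prime (pdiv v) by apply: pdiv_prime; lia.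
have : (pdiv v ^ 2 %| 2 * q)%N by apply: dvdn_trans dv; rewrite dvdn_exp2r ?pdiv_dvd.
rewrite pfactor_dvdn // lognM // (logn_prime _ (isT : prime 2)) (logn_prime _ q_pr).
have [->|] := eqVneq (pdiv v) 2%N; last by case: (pdiv v == q).
by case: (2 =P q)%N q_odd => // <-.
Qed.

(** The square of the denominator of [r] divides [2q], which is squarefree. *)
Lemma rat_sqr_2prime_int (q : nat) (r : rat) (m : int) :
  prime q -> odd q -> (2 * q)%:R * r ^+ 2 = m%:~R -> exists y : int, r = y%:~R.
Proof.
move=> q_pr q_odd e.
have dq : (denq r != 0) by rewrite denq_neq0.
have {}e : (2 * q)%:Z * numq r ^+ 2 = m * denq r ^+ 2.
  apply: (@intr_inj rat); rewrite !(rmorphXn, rmorphM) /= -e -{2}(divq_num_den r).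
  by rewrite -[(_%:Z)%:~R]/((2 * q)%:R); field; rewrite intr_eq0.
have : (`|denq r| ^ 2 %| 2 * q)%N.
  rewrite -(@Gauss_dvdl _ _ (`|numq r| ^ 2)).
    have := congr1 absz e; rewrite !(abszX, abszM) absz_nat => ->.
    exact: dvdn_mull.
  by rewrite coprimeXl // coprimeXr // coprime_sym coprime_num_den.
move/(dvd_sqr_2prime q_pr q_odd) => d1; exists (numq r).
rewrite -{1}(divq_num_den r) -(gez0_abs (denq_ge0 r)) d1 divr1 //.
Qed.

Lemma exists_odd_near (R : realType) (z : R) : exists a : int,
  (2 * a + 1)%:~R - 1 <= z < (2 * a + 1)%:~R + 1.
Proof.
exists (Num.floor (z / 2)); have := floor_itv (z / 2).
by rewrite !(rmorphD, rmorphM) /=; lra.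
Qed.

Section SqrtTwoPrime.
Variables (R : realType) (q : nat) (s : R).
Hypotheses (q_pr : prime q) (q_odd : odd q).
Hypotheses (s_ge0 : 0 <= s) (s_sqr : s ^+ 2 = (2 * q)%:R).

Lemma sqrt_2prime_ge2 : 2 <= s.
Proof.
rewrite -(@ler_pXn2r _ 2) ?nnegrE // s_sqr -natrX ler_nat.
by have := prime_gt1 q_pr; lia.
Qed.

Lemma sqrt_2prime_irr (x y : int) : x%:~R = y%:~R * s -> y = 0.
Proof.
move=> e; have : (x ^+ 2) = (2 * q)%:Z * y ^+ 2.
  apply: (@intr_inj R); rewrite !(rmorphXn, rmorphM) /= e exprMn s_sqr mulrC.
  by [].
move/(congr1 absz); rewrite !(abszX, abszM) absz_nat.
move=> /(sqr_eq_2prime_sqr q_pr q_odd) y0.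
by apply/eqP; rewrite -absz_eq0 y0.
Qed.

Lemma exists_odd_near_sqrt (b : nat) : (0 < b)%N ->
  exists k : int, `|(2 * k + 1)%:~R - b%:R * s| < 1.
Proof.
move=> b_gt0; have [k /andP[k1 k2]] := exists_odd_near (b%:R * s).
exists k; rewrite ltr_norml; apply/andP; split; first lra.
(* Strictness holds because equality would mean [b s = 2k], against the irrationality of [s]. *)
rewrite lt_neqAle; apply/andP; split; last lra.
apply/eqP => e; have : (2 * k)%:~R = b%:~R * s.
  by move: e; rewrite rmorphD /= -[b%:~R]/(b%:R); lra.
by move/sqrt_2prime_irr => b0; lia.
Qed.

(* If q divides the odd integer k nearest to 2^j s, then the odd integer
   nearest to 2^(j+1) s is 2k + 1 or 2k - 1, which q does not divide. *)
Lemma exists_coprime_near_sqrt (j : nat) :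
  exists (i : nat) (a : int), [/\ (j <= i <= j.+1)%N,
    coprimez a ((2 * q)%:Z * ((2 ^ i)%:Z) ^+ 2), (exists k : int, a = 2 * k + 1) &
    `|a%:~R - (2 ^ i)%:R * s| < 1].
Proof.
have cop (a : int) (i : nat) : ~~ (q%:Z %| 2 * a + 1)%Z ->
    coprimez (2 * a + 1) ((2 * q)%:Z * ((2 ^ i)%:Z) ^+ 2).
  move=> qa; rewrite coprimezE !(abszX, abszM) !absz_nat !coprimeMr.
  have a2 : coprime `|(2 * a + 1)%R| 2 by rewrite coprimen2; lia.
  rewrite a2 coprimeXr ?coprimeXr // andbT /=.
  by move: qa; rewrite dvdzE absz_nat coprime_sym prime_coprime // andbT.
have [k hk] := exists_odd_near_sqrt (expn_gt0 2 j).
have [qk|qk] := boolP (q%:Z %| 2 * k + 1)%Z; last first.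
  by exists j, (2 * k + 1); split => //; [lia | exact: cop | exists k].
have [k' hk'] := exists_odd_near_sqrt (expn_gt0 2 j.+1).
exists j.+1, (2 * k' + 1); split => //; [lia | apply: cop | by exists k'].
(* The difference is odd and of absolute value less than [1 + 2 * 1]. *)
have kk' : (2 * k' + 1) - 2 * (2 * k + 1) = 1 \/ (2 * k' + 1) - 2 * (2 * k + 1) = - 1.
  have : (-3)%:~R < ((2 * k' + 1) - 2 * (2 * k + 1))%:~R :> R /\
    ((2 * k' + 1) - 2 * (2 * k + 1))%:~R < 3%:~R :> R.
    move: hk hk'; rewrite expnS natrM !ltr_norml rmorphB rmorphM /=.
    by move=> /andP[? ?] /andP[? ?]; split; lra.
  by rewrite !ltr_int => -[]; lia.
apply/negP => qk'; have := prime_gt1 q_pr.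
have : (q%:Z %| 1%R)%Z.
  case: kk' => e; last rewrite -rpredN; rewrite -e rpredB ?dvdz_mull //.
move/dvdzP => [c] /(congr1 absz); rewrite abszM absz_nat => /esym/eqP.
by rewrite muln_eq1 => /andP[_ /eqP ->].
Qed.
End SqrtTwoPrime.

(** * The real-valued modulus, and pairs stable under complex conjugation *)

Section ComplexModulus.
Variable R : realType.
Local Notation C := (complex R).
Local Notation RC := (real_complex_def (Phant R)).
Implicit Types z w : C.

Lemma normc_cabs z : `|z| = RC (cabs z).
Proof. by rewrite /cabs normc_def. Qed.

Lemma cabs_ge0 z : 0 <= cabs z.
Proof. by rewrite -ler0c -normc_cabs. Qed.

Lemma cabsM z w : cabs (z * w) = cabs z * cabs w.
Proof. by apply: complexI; rewrite rmorphM /= -!normc_cabs normrM. Qed.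

Lemma cabsD z w : cabs (z + w) <= cabs z + cabs w.
Proof. by rewrite -lecR rmorphD /= -!normc_cabs ler_normD. Qed.

Lemma cabsN z : cabs (- z) = cabs z.
Proof. by apply: complexI; rewrite -!normc_cabs normrN. Qed.

Lemma cabsJ z : cabs (conjc z) = cabs z.
Proof. by apply: complexI; rewrite -!normc_cabs normcJ. Qed.

Lemma cabs_real (x : R) : cabs (RC x) = `|x|.
Proof. by rewrite /cabs normc_def /= expr0n addr0 sqrtr_sqr. Qed.

Lemma conjc_fixed z : conjc z = z -> z = RC (complex.Re z).
Proof. by case: z => a b [] /= e; congr Complex; lra. Qed.

Lemma conjc_closed_pair z w : conjc z \in [:: z; w] -> conjc w \in [:: z; w] ->
  conjc (z + w) = z + w /\ conjc (z * w) = z * w.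
Proof.
have cK := @conjcK R.
rewrite !inE rmorphD rmorphM /=.
move=> /orP[/eqP zz|/eqP zw] /orP[/eqP wz|/eqP ww].
- by have -> : w = z; rewrite ?zz // -(cK w) wz zz.
- by rewrite zz ww.
- by rewrite zw wz addrC mulrC.
- by have <- : w = z; rewrite ?ww // -(cK z) zw ww.
Qed.

End ComplexModulus.

(** * Monic quadratics, and the splitting of a quartic into inner and outer pairs of roots *)

Section Quadratic.

Definition quad (T : nzRingType) (u w : T) : {poly T} := 'X^2 - u *: 'X + w%:P.

Lemma coef_quad (T : nzRingType) (u w : T) :
  ((quad u w)`_0 = w) * ((quad u w)`_1 = - u) * ((quad u w)`_2 = 1).
Proof.
by rewrite /quad !coefD !coefN !coefZ !coefXn !coefX !coefC /=; split; [split|];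
   rewrite ?mulr0 ?mulr1 ?subr0 ?addr0 ?add0r // subr0.
Qed.

Lemma size_quad (T : nzRingType) (u w : T) : size (quad u w) = 3%N.
Proof.
rewrite /quad -addrA size_polyDl ?size_polyXn //.
apply: leq_ltn_trans (size_polyD _ _) _; rewrite gtn_max size_polyN.
rewrite (leq_ltn_trans (size_scale_leq _ _)) ?size_polyX //=.
by rewrite (leq_ltn_trans (size_polyC_leq1 _)).
Qed.

Lemma monic_quad (T : nzRingType) (u w : T) : quad u w \is monic.
Proof. by rewrite monicE /lead_coef size_quad coef_quad. Qed.

Lemma map_quad (S T : nzRingType) (f : {rmorphism S -> T}) (u w : S) :
  map_poly f (quad u w) = quad (f u) (f w).
Proof.
by rewrite /quad rmorphD rmorphB /= map_polyZ map_polyXn map_polyX map_polyC.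
Qed.

Lemma quad_inj (T : nzRingType) (u w u' w' : T) :
  quad u w = quad u' w' -> u = u' /\ w = w'.
Proof.
move=> e; have := coef_quad u w; rewrite e !coef_quad => -[[-> /oppr_inj ->] _].
by [].
Qed.

Lemma quad_roots (T : comNzRingType) (a b : T) :
  ('X - a%:P) * ('X - b%:P) = quad (a + b) (a * b).
Proof. by rewrite /quad polyCM -mul_polyC polyCD; ring. Qed.

Lemma coef_quad_mul (T : comNzRingType) (u w u' w' : T) (i : nat) :
  (quad u w * quad u' w')`_i =
    nth 0 [:: w * w'; - (u * w' + u' * w); w + w' + u * u'; - (u + u'); 1] i.
Proof.
rewrite coefM.
have z v x j : (quad v x : {poly T})`_j.+3 = 0 by rewrite nth_default ?size_quad.
case: i => [|[|[|[|[|i]]]]].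
- by rewrite big_ord1 !coef_quad.
- by rewrite !big_ord_recr big_ord0 /= !coef_quad; ring.
- by rewrite !big_ord_recr big_ord0 /= !coef_quad; ring.
- by rewrite !big_ord_recr big_ord0 /= !coef_quad !z; ring.
- by rewrite !big_ord_recr big_ord0 /= !coef_quad !z; ring.
rewrite [RHS]nth_default // big1 // => -[j jlt] _ /=.
case: j jlt => [|[|[|j]]] jlt; rewrite ?z ?mul0r // ?subn0 ?subSS ?subn0 ?z ?mulr0 //.
Qed.

End Quadratic.

Section ConjugateSplitting.
Variable R : realType.
Local Notation C := (complex R).
Local Notation RC := (real_complex_def (Phant R)).

Definition polyZR (p : {poly int}) : {poly R} := map_poly (fun z : int => z%:~R) p.

Lemma polyZC_polyZR (p : {poly int}) : polyZC R p = map_poly RC (polyZR p).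
Proof.
by rewrite /polyZC /polyZR -map_poly_comp; apply: eq_map_poly => z /=; rewrite rmorph_int.
Qed.

Lemma map_conjc_polyZC (p : {poly int}) : map_poly (@conjc R) (polyZC R p) = polyZC R p.
Proof.
by rewrite /polyZC -map_poly_comp; apply: eq_map_poly => z /=; rewrite rmorph_int.
Qed.

Lemma root_conjc_polyZC (p : {poly int}) (z : C) :
  root (polyZC R p) z -> root (polyZC R p) (conjc z).
Proof. by rewrite -{2}(map_conjc_polyZC p) complex_root_conj conjcK. Qed.

(** Complex conjugation permutes the roots and preserves their moduli, so it stabilizes both the
    pair inside the unit disk and the pair outside. The monic quadratic of each pair is therefore
    real. *)
Lemma conjugates_split (p : {poly int}) (rs : seq C) :
  p != 0 -> polyZC R p = (lead_coef p)%:~R *: \prod_(r <- rs) ('X - r%:P) ->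
  size rs = 4%N -> count (fun r => cabs r < 1) rs = 2%N ->
  exists U1 W1 U2 W2 : R,
    polyZR p = (lead_coef p)%:~R *: (quad U1 W1 * quad U2 W2) /\
    \prod_(r <- rs) Num.max 1 (cabs r) = `|W1| /\
    [/\ 1 <= `|W1|, `|W2| < 1, `|U1| <= 2 * `|W1| & `|U2| < 2].
Proof.
move=> p_neq0 pE rs4 rs2.
pose inner (r : C) := cabs r < 1.
have memr r : root (polyZC R p) r = (r \in rs).
  by rewrite pE rootZ ?root_prod_XsubC // intr_eq0 lead_coef_eq0.
have conj_rs r : r \in rs -> conjc r \in rs.
  by rewrite -!memr; exact: root_conjc_polyZC.
have perm : perm_eq (seq.filter (predC inner) rs ++ seq.filter inner rs) rs.
  by rewrite perm_catC perm_filterC.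
have : size (seq.filter inner rs) = 2%N by rewrite size_filter.
have : size (seq.filter (predC inner) rs) = 2%N.
  by rewrite size_filter; have := count_predC inner rs; rewrite rs2 rs4; lia.
have conj_in (P : pred C) : (forall r, P (conjc r) = P r) ->
    forall r, r \in seq.filter P rs -> conjc r \in seq.filter P rs.
  by move=> Pc r; rewrite !mem_filter Pc => /andP[-> /conj_rs ->].
have conj2 (P : pred C) a b : (forall r, P (conjc r) = P r) ->
    seq.filter P rs = [:: a; b] ->
    [/\ a + b = RC (complex.Re (a + b)), a * b = RC (complex.Re (a * b)), P a & P b].
  move=> Pc e; have := conj_in P Pc; rewrite e => ab.
  have aP : a \in seq.filter P rs by rewrite e inE eqxx.
  have bP : b \in seq.filter P rs by rewrite e !inE eqxx orbT.
  have aM : a \in [:: a; b] by rewrite inE eqxx.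
  have bM : b \in [:: a; b] by rewrite !inE eqxx orbT.
  have [/conjc_fixed ? /conjc_fixed ?] := conjc_closed_pair (ab a aM) (ab b bM).
  split=> //.
  - by move: aP; rewrite mem_filter => /andP[].
  - by move: bP; rewrite mem_filter => /andP[].
case e1 : (seq.filter (predC inner) rs) => [|a [|b [|]]] // _.
case e2 : (seq.filter inner rs) => [|c [|d [|]]] // _.
have [abS abP na nb] := conj2 _ _ _ (fun r => congr1 (fun x => ~~ (x < 1)) (cabsJ r)) e1.
have [cdS cdP nc nd] := conj2 _ _ _ (fun r => congr1 (fun x => x < 1) (cabsJ r)) e2.
have {na} na : 1 <= cabs a by rewrite leNgt.
have {nb} nb : 1 <= cabs b by rewrite leNgt.
rewrite /inner in nc nd.
move: perm; rewrite e1 e2 /= => perm.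
exists (complex.Re (a + b)), (complex.Re (a * b)), (complex.Re (c + d)), (complex.Re (c * d)).
have nW1 : `|complex.Re (a * b)| = cabs a * cabs b by rewrite -cabs_real -abP cabsM.
have nW2 : `|complex.Re (c * d)| = cabs c * cabs d by rewrite -cabs_real -cdP cabsM.
have nU1 : `|complex.Re (a + b)| <= cabs a + cabs b by rewrite -cabs_real -abS cabsD.
have nU2 : `|complex.Re (c + d)| <= cabs c + cabs d by rewrite -cabs_real -cdS cabsD.
have c0 := cabs_ge0 c; have d0 := cabs_ge0 d.
split.
  apply: (@map_poly_inj _ _ RC); rewrite -polyZC_polyZR pE map_polyZ rmorphM /=.
  rewrite !map_quad /= -abS -abP -cdS -cdP -!quad_roots rmorph_int.
  rewrite -(perm_big _ perm) /= !big_cons big_nil; congr (_ *: _).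
  by rewrite (mulr1 ('X - d%:P)) !mulrA.
split.
  rewrite -(perm_big _ perm) /= !big_cons big_nil mulr1 nW1.
  by rewrite (max_r na) (max_r nb) (max_l (ltW nc)) (max_l (ltW nd)) !mulr1.
(* The bound on [U1] is [|a| + |b| <= 1 + |a b| <= 2 |a b|], from [(|a| - 1) (|b| - 1) >= 0]. *)
by split; rewrite ?nW1 ?nW2; nra.
Qed.

End ConjugateSplitting.

(** * Factorization of a quartic over the field [Q(s)] *)

Section QuadraticField.
Variables (R : realType) (q : nat) (s : R).
Hypotheses (q_pr : prime q) (q_odd : odd q) (s_sqr : s ^+ 2 = (2 * q)%:R).

Lemma coef_polyZR (p : {poly int}) (i : nat) : (polyZR R p)`_i = (p`_i)%:~R.
Proof. by rewrite coef_map. Qed.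

Lemma polyZR_ratr (p : {poly int}) :
  polyZR R p = map_poly (ratr : rat -> R) (map_poly (fun z : int => z%:~R) p).
Proof. by rewrite -map_poly_comp; apply: eq_map_poly => z /=; rewrite ratr_int. Qed.

Definition in_sqrt_field (z : R) := exists u v : rat, z = ratr u + ratr v * s.

Lemma in_sqrt_field_int (m : int) : in_sqrt_field m%:~R.
Proof. by exists m%:~R, 0; rewrite rmorph0 mul0r addr0 ratr_int. Qed.

Lemma in_sqrt_fieldB (z w : R) :
  in_sqrt_field z -> in_sqrt_field w -> in_sqrt_field (z - w).
Proof.
move=> [u [v ->]] [u' [v' ->]]; exists (u - u'), (v - v').
by rewrite !rmorphB /=; ring.
Qed.

Lemma ratr_2prime : ratr (2 * q)%:R = s ^+ 2.
Proof. by rewrite s_sqr ratr_nat. Qed.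

Lemma in_sqrt_fieldM (z w : R) :
  in_sqrt_field z -> in_sqrt_field w -> in_sqrt_field (z * w).
Proof.
move=> [u [v ->]] [u' [v' ->]].
exists (u * u' + (2 * q)%:R * (v * v')), (u * v' + v * u').
move: ((2 * q)%:R : rat) ratr_2prime => D DE.
by rewrite !(rmorphD, rmorphM) /= DE; ring.
Qed.

Lemma sqrt_2prime_ratr (u v : rat) : ratr u + ratr v * s = 0 -> u = 0 /\ v = 0.
Proof.
move=> e; suff v0 : v = 0.
  by move: e; rewrite v0 rmorph0 mul0r addr0 => /eqP; rewrite fmorph_eq0 => /eqP.
have : (- numq u * denq v)%:~R = (numq v * denq u)%:~R * s.
  have du : (denq u)%:~R != 0 :> R by rewrite intr_eq0 denq_neq0.
  have dv : (denq v)%:~R != 0 :> R by rewrite intr_eq0 denq_neq0.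
  move: e; rewrite /ratr !rmorphM rmorphN /= => e.
  have -> : (numq v)%:~R * (denq u)%:~R * s =
    (numq v)%:~R / (denq v)%:~R * s * (denq u)%:~R * (denq v)%:~R by field.
  have -> : (numq v)%:~R / (denq v)%:~R * s = - ((numq u)%:~R / (denq u)%:~R) by lra.
  by field; rewrite ?du ?dv.
move/(sqrt_2prime_irr q_pr q_odd s_sqr)/eqP; rewrite mulf_eq0 numq_eq0 (negPf (denq_neq0 _)) orbF.
by move/eqP.
Qed.

Lemma in_sqrt_fieldV (z : R) : in_sqrt_field z -> in_sqrt_field z^-1.
Proof.
move=> [u [v zE]]; have [z0|z_neq0] := eqVneq z 0.
  by rewrite z0 invr0; exact: (in_sqrt_field_int 0).
have N_neq0 : ratr u - ratr v * s != 0.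
  apply: contraNneq z_neq0 => e; have [u0 v0] : u = 0 /\ - v = 0.
    by apply: sqrt_2prime_ratr; rewrite rmorphN mulNr.
  by rewrite zE u0 -[v]opprK v0 oppr0 !rmorph0 mul0r addr0.
have [D DE] : exists D : rat, ratr D = s ^+ 2 by exists (2 * q)%:R; exact: ratr_2prime.
pose N := u ^+ 2 - D * v ^+ 2.
exists (u / N), (- v / N).
have NE : ratr N = z * (ratr u - ratr v * s).
  by rewrite /N !(rmorphB, rmorphXn, rmorphM) /= DE zE; ring.
rewrite !fmorph_div rmorphN /= NE.
by field; rewrite N_neq0 z_neq0.
Qed.

(** The product [g] of [quad U1 W1] with its conjugate over [Q(s)] has rational coefficients. It
    shares a factor with the irreducible [f] and has the same degree, so it is [f] up to a constant;
    cancelling [quad U1 W1] identifies [quad U2 W2] as the conjugate. *)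
Lemma irreducible_quartic_conjugate (f : {poly rat}) (U1 W1 U2 W2 : R) (u v w t a0 : rat) :
  size f = 5%N -> irreducible_poly f -> a0 != 0 ->
  map_poly ratr f = ratr a0 *: (quad U1 W1 * quad U2 W2) ->
  U1 = ratr u + ratr v * s -> W1 = ratr w + ratr t * s ->
  U2 = ratr u - ratr v * s /\ W2 = ratr w - ratr t * s.
Proof.
move=> f5 f_irr a0_neq0 fE U1E W1E.
have [D DE] : exists D : rat, ratr D = s ^+ 2 by exists (2 * q)%:R; exact: ratr_2prime.
pose g := quad u w ^+ 2 - D%:P * (v *: 'X - t%:P) ^+ 2.
have gE : map_poly ratr g = quad U1 W1 * quad (ratr u - ratr v * s) (ratr w - ratr t * s).
  rewrite /g !(rmorphXn, rmorphB, rmorphM) /= !map_quad map_polyZ map_polyX !map_polyC /=.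
  rewrite DE U1E W1E /quad -!mul_polyC !(polyC_exp, polyCD, polyCN, polyCM, polyCB).
  by ring.
have g5 : size g = 5%N.
  by rewrite -(size_map_poly (ratr : {rmorphism rat -> R})) gE size_Mmonic ?monic_quad
    -?size_poly_gt0 ?size_quad.
have : ~~ coprimep f g.
  rewrite -(coprimep_map (ratr : {rmorphism rat -> R})) fE gE.
  rewrite coprimepZl ?fmorph_eq0 //; apply/negP => cop.
  have : coprimep (quad U1 W1) (quad U1 W1).
    by apply: coprimep_dvdl (coprimep_dvdr _ cop); apply: dvdp_mulr.
  by rewrite coprimepp size_quad.
move=> ncop; have fg : f %| g.
  by apply: contraR ncop; rewrite (irreducible_poly_coprime _ f_irr).
have /eqp_eq : f %= g by rewrite -dvdp_size_eqp // f5 g5.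
have monicPQ (z x z' x' : R) : quad z x * quad z' x' \is monic.
  by rewrite rpredM // monic_quad.
have -> : lead_coef g = 1.
  apply: (fmorph_inj (ratr : {rmorphism rat -> R})).
  by rewrite -lead_coef_map gE (eqP (monicPQ _ _ _ _)) rmorph1.
have -> : lead_coef f = a0.
  apply: (fmorph_inj (ratr : {rmorphism rat -> R})).
  by rewrite -lead_coef_map fE lead_coefZ (eqP (monicPQ _ _ _ _)) mulr1.
rewrite scale1r => fg'; move: fE; rewrite fg' map_polyZ gE.
have ra0 : ratr a0 != 0 :> R by rewrite fmorph_eq0.
move/(scalerI ra0)/(mulfI (monic_neq0 (monic_quad _ _))).
by move/quad_inj => -[-> ->].
Qed.

Lemma ratr_divz (m n : int) : ratr (m%:~R / n%:~R : rat) = m%:~R / n%:~R :> R.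
Proof. by rewrite rmorphM fmorphV /= !ratr_int. Qed.

Lemma in_sqrt_field_div (m n : int) (z : R) :
  in_sqrt_field z -> in_sqrt_field (m%:~R / n%:~R * z).
Proof.
move=> zK; apply: in_sqrt_fieldM => //; apply: in_sqrt_fieldM; first exact: in_sqrt_field_int.
by apply: in_sqrt_fieldV; exact: in_sqrt_field_int.
Qed.

(** Once [U1] is known to lie in [Q(s)], the second factor is the conjugate of the first and the
    equations result from comparing coefficients. *)
Lemma irreducible_quartic_coefs (p : {poly int}) (U1 W1 U2 W2 : R) (A B : int) :
  irreducible_poly (map_poly (fun z : int => z%:~R : rat) p) ->
  lead_coef p != 0 ->
  polyZR R p = (lead_coef p)%:~R *: (quad U1 W1 * quad U2 W2) ->
  1 <= `|W1| -> `|W2| < 1 -> (lead_coef p)%:~R * W1 = A%:~R + B%:~R * s ->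
  size p = 5%N /\ exists y : int,
    [/\ (2 * lead_coef p)%:~R * U1 = (- p`_3)%:~R + y%:~R * s,
        (2 * lead_coef p)%:~R * U2 = (- p`_3)%:~R - y%:~R * s,
        4 * lead_coef p * p`_2 = 8 * lead_coef p * A + p`_3 ^+ 2 - (2 * q)%:Z * y ^+ 2,
        lead_coef p * p`_1 = p`_3 * A + (2 * q)%:Z * y * B &
        lead_coef p * p`_0 = A ^+ 2 - (2 * q)%:Z * B ^+ 2].
Proof.
move=> p_irr; set a0 := lead_coef p => a0_neq0 pE nW1 nW2 W1E.
have ra0 : a0%:~R != 0 :> R by rewrite intr_eq0.
have W1_neq0 : W1 != 0 by apply: contraTneq nW1 => ->; rewrite normr0 ler10.
have W21 : W2 - W1 != 0 by apply: contraTneq nW2 => /subr0_eq ->; rewrite -leNgt.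
have p5 : size p = 5%N.
  rewrite -(@size_map_inj_poly _ _ (fun z : int => z%:~R : R)) //; last exact: intr_inj.
  rewrite -/(polyZR R p) pE size_scale // size_Mmonic ?monic_quad //.
    by rewrite !size_quad.
  by rewrite -size_poly_gt0 size_quad.
have cE i : (p`_i)%:~R = a0%:~R *
    nth 0 [:: W1 * W2; - (U1 * W2 + U2 * W1); W1 + W2 + U1 * U2; - (U1 + U2); 1] i.
  by rewrite -coef_quad_mul -coefZ -pE coef_polyZR.
move: (cE 0%N) (cE 1%N) (cE 2%N) (cE 3%N) => /= c0 c1 c2 c3.
have W1f : W1 = A%:~R / a0%:~R + B%:~R / a0%:~R * s.
  by apply: (mulfI ra0); rewrite W1E; field.
have W1K : in_sqrt_field W1.
  by exists (A%:~R / a0%:~R), (B%:~R / a0%:~R); rewrite !ratr_divz.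
have W2K : in_sqrt_field W2.
  have -> : W2 = (p`_0)%:~R / a0%:~R * W1^-1 by rewrite c0; field; rewrite ra0 W1_neq0.
  exact/in_sqrt_field_div/in_sqrt_fieldV.
(* The coefficients of degrees 3 and 1 are linear in [U1] and [U2]; the system is solvable because
   [|W2| < 1 <= |W1|] separates [W1] from [W2]. *)
have [u [v U1E]] : in_sqrt_field U1.
  have -> : U1 = ((p`_3)%:~R / a0%:~R * W1 - (p`_1)%:~R / a0%:~R * 1%:~R) * (W2 - W1)^-1.
    by rewrite c3 c1; field; rewrite ra0 W21.
  apply: in_sqrt_fieldM; last exact/in_sqrt_fieldV/in_sqrt_fieldB.
  by apply: in_sqrt_fieldB; apply: in_sqrt_field_div => //; exact: in_sqrt_field_int.
have f5 : size (map_poly (fun z : int => z%:~R : rat) p) = 5%N.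
  by rewrite size_map_inj_poly //; exact: intr_inj.
have qa0 : a0%:~R != 0 :> rat by rewrite intr_eq0.
have fE : map_poly ratr (map_poly (fun z : int => z%:~R : rat) p) =
    ratr a0%:~R *: (quad U1 W1 * quad U2 W2) by rewrite -polyZR_ratr ratr_int.
have W1r : W1 = ratr (A%:~R / a0%:~R) + ratr (B%:~R / a0%:~R) * s by rewrite !ratr_divz.
have [U2E W2E] := irreducible_quartic_conjugate f5 p_irr qa0 fE U1E W1r.
rewrite !ratr_divz in W2E.
have p3E : (p`_3)%:~R = - (2 * a0%:~R * ratr u) :> R by rewrite c3 U1E U2E; ring.
have p2E : (p`_2)%:~R = 2 * A%:~R + a0%:~R * (ratr u ^+ 2 - ratr v ^+ 2 * s ^+ 2) :> R.
  by rewrite c2 W1f W2E U1E U2E; field.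
(* The coefficient of degree 2 shows that [2q (2 a0 v)^2] is an integer. *)
have [y yE] : exists y : int, 2 * a0%:~R * v = y%:~R.
  apply: (@rat_sqr_2prime_int q _ (8 * a0 * A + p`_3 ^+ 2 - 4 * a0 * p`_2)) => //.
  apply: (fmorph_inj (ratr : {rmorphism rat -> R})).
  have [D D2q DE] : exists2 D : rat, D = (2 * q)%:R & ratr D = s ^+ 2.
    by exists (2 * q)%:R => //; exact: ratr_2prime.
  rewrite -D2q.
  rewrite !(rmorphXn, rmorphM, rmorphD, rmorphN) /= DE !ratr_int.
  by rewrite p3E p2E; ring.
have {}yE : 2 * a0%:~R * ratr v = y%:~R :> R.
  by rewrite -(ratr_int _ y) -yE !rmorphM /= ratr_int ratr_nat.
have [D D2q sD] : exists2 D : int, D = (2 * q)%:Z & D%:~R = s ^+ 2.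
  by exists (2 * q)%:Z => //; rewrite s_sqr.
rewrite -D2q; split=> //; exists y; split.
- by rewrite rmorphM rmorphN /= p3E -yE U1E; ring.
- by rewrite rmorphM rmorphN /= p3E -yE U2E; ring.
- apply: (@intr_inj R); rewrite !(rmorphXn, rmorphM, rmorphD, rmorphN) /=.
  by rewrite sD p3E p2E -yE; ring.
- apply: (@intr_inj R); rewrite !(rmorphXn, rmorphM, rmorphD, rmorphN) /=.
  by rewrite sD p3E c1 W1f W2E U1E U2E -yE; field.
- apply: (@intr_inj R); rewrite !(rmorphXn, rmorphM, rmorphD, rmorphN) /=.
  by rewrite sD c0 W1f W2E; field.
Qed.

End QuadraticField.

(** * Upper bound: coding the minimal polynomials *)

(** A list of codes yields a list of the coded objects, which bounds their number; a code of no
    object is sent to the default [t0]. *)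
Lemma seq_of_codes (T : choiceType) (t0 : T) (X : eqType) (code : X -> T -> Prop)
    (cs : seq X) : (forall c t t', code c t -> code c t' -> t = t') ->
  exists ts : seq T, size ts = size cs /\
    forall c t, c \in cs -> code c t -> t \in ts.
Proof.
move=> code_inj; exists [seq xget t0 [set t | code c t] | c <- cs].
rewrite size_map; split=> // c t ccs ct; apply/mapP; exists c => //.
exact: code_inj ct (@xgetPex _ t0 [set t | code c t] (ex_intro _ t ct)).
Qed.

Lemma size_flatten_map_le (S T : Type) (f : S -> seq T) (m : nat) (ss : seq S) :
  (forall x, size (f x) <= m)%N -> (size (flatten (map f ss)) <= m * size ss)%N.
Proof.
move=> fm; elim: ss => [|x ss IH] /=; first by rewrite muln0.
by rewrite size_cat mulnS leq_add.
Qed.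

Section UpperBound.
Variables (R : realType) (q : nat) (s : R) (a : int) (b : nat).
Hypotheses (q_pr : prime q) (q_odd : odd q).
Hypotheses (s_ge0 : 0 <= s) (s_sqr : s ^+ 2 = (2 * q)%:R) (b_gt0 : (0 < b)%N).
Hypotheses (near : `|a%:~R - b%:R * s| < 1).
Hypotheses (cop : coprimez a ((2 * q)%:Z * b%:Z ^+ 2)).
Local Notation C := (complex R).
Local Notation h := (a%:~R + b%:R * s).

Lemma height_lb : 2 * (b%:R * s) - 1 < h.
Proof. by move: near; rewrite ltr_norml => /andP[? ?]; lra. Qed.

Lemma height_ub : h < 2 * (b%:R * s) + 1.
Proof. by move: near; rewrite ltr_norml => /andP[? ?]; lra. Qed.

Lemma bs_ge2 : 2 <= b%:R * s.
Proof.
have s2 := sqrt_2prime_ge2 q_pr q_odd s_ge0 s_sqr.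
have : 1 <= b%:R :> R by rewrite ler1n.
by nra.
Qed.

Lemma powR_fourth_root_inj (x y : R) :
  0 <= x -> 0 <= y -> powR x (4%:R)^-1 = powR y (4%:R)^-1 -> x = y.
Proof.
have K (z : R) : 0 <= z -> powR (powR z (4%:R)^-1) 4%:R = z.
  by move=> z0; rewrite -powRrM mulVf ?pnatr_eq0 // powRr1.
by move=> x0 y0 e; rewrite -(K x) // e K.
Qed.

Lemma zcontents1_lead (p : {poly int}) : zcontents p = 1 -> 0 < lead_coef p.
Proof. by move=> p1; rewrite -sgz_gt0 -sgz_contents p1. Qed.

(* (-1) ^+ e is the sign of the product of the two conjugates of modulus at
   least 1; y is the coefficient of s in twice lead_coef p times their sum. *)
Definition quartic_code (e : bool) (y : int) (p : {poly int}) :=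
  [/\ 0 < lead_coef p, size p = 5%N,
      4 * lead_coef p * p`_2 = 8 * lead_coef p * ((-1) ^+ e * a) + p`_3 ^+ 2
        - (2 * q)%:Z * y ^+ 2,
      lead_coef p * p`_1 = p`_3 * ((-1) ^+ e * a) + (2 * q)%:Z * y * ((-1) ^+ e * b%:Z) &
      lead_coef p * p`_0 = a ^+ 2 - (2 * q)%:Z * b%:Z ^+ 2].

(* p`_3 is fixed modulo lead_coef p by the code, so it remains to say in which
   interval of length lead_coef p it lies. *)
Definition slot (y : int) (p : {poly int}) : int :=
  Num.floor ((- (p`_3)%:~R - y%:~R * s) / (lead_coef p)%:~R).

(** The linear coefficient equation fixes [p]_3[modulo]lead_coef
    p[, because the latter is prime to]a[; the slot then fixes]p[_3] itself, and the other equations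
    yield the remaining coefficients. *)
Lemma quartic_code_inj e y p p' : quartic_code e y p -> quartic_code e y p' ->
  lead_coef p = lead_coef p' -> slot y p = slot y p' -> p = p'.
Proof.
move=> [l0 p5 p2 p1 p0] [l0' p5' p2' p1' p0'] ll.
rewrite /slot -ll in p2' p1' p0' l0' * => kk.
(* The leading coefficient divides [a^2 - 2q b^2], and [a] is prime to [2q b^2]. *)
have cop' : coprimez (lead_coef p) a.
  have [[u v] /= uv] := coprimezP _ _ cop.
  have : coprimez (a ^+ 2 - (2 * q)%:Z * b%:Z ^+ 2) a.
    by apply/coprimezP; exists (- v, u + v * a); rewrite /= -uv; ring.
  by apply: coprimez_dvdl; rewrite -p0; apply: dvdz_mulr; exact: dvdzz.
have l_neq0 : lead_coef p != 0 by rewrite gt_eqF.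
have d3 : (lead_coef p %| p`_3 - p'`_3)%Z.
  rewrite -(Gauss_dvdzl _ cop'); apply/dvdzP.
  exists ((-1) ^+ e * (p`_1 - p'`_1)).
  have : lead_coef p * (p`_1 - p'`_1) = (-1) ^+ e * ((p`_3 - p'`_3) * a).
    by rewrite mulrBr p1 p1'; ring.
  by rewrite -mulrA [_ * lead_coef p]mulrC => ->; rewrite mulrA -expr2 sqrr_sign mul1r.
(* Two values in the same slot differ by less than [lead_coef p], which divides their difference. *)
have e3 : p`_3 = p'`_3.
  have lR : 0 < (lead_coef p)%:~R :> R by rewrite ltr0z.
  have := floor_itv ((- (p`_3)%:~R - y%:~R * s) / (lead_coef p)%:~R).
  have := floor_itv ((- (p'`_3)%:~R - y%:~R * s) / (lead_coef p)%:~R).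
  rewrite kk; move: (Num.floor _) => k.
  rewrite !ler_pdivlMr // !ltr_pdivrMr // rmorphD /= => /andP[k1 k2] /andP[k3 k4].
  have : (p`_3 - p'`_3)%:~R < (lead_coef p)%:~R :> R by rewrite rmorphB /=; lra.
  have : (- lead_coef p)%:~R < (p`_3 - p'`_3)%:~R :> R by rewrite rmorphB rmorphN /=; lra.
  rewrite !ltr_int; case/dvdzP: d3 => c cE; rewrite cE => lt1 lt2.
  have c0 : c = 0.
    move: lt1 lt2; rewrite -mulN1r -{4}[lead_coef p]mul1r !ltr_pM2r //.
    by clear; lia.
  by apply/eqP; rewrite -subr_eq0 cE c0 mul0r.
have e2 : p`_2 = p'`_2.
  have : 4 * lead_coef p * p`_2 = 4 * lead_coef p * p'`_2 by rewrite p2 p2' e3.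
  by apply: mulfI; rewrite mulf_neq0.
have e1 : p`_1 = p'`_1 by apply: (mulfI l_neq0); rewrite p1 p1' e3.
have e0 : p`_0 = p'`_0 by apply: (mulfI l_neq0); rewrite p0 p0'.
have e4 : p`_4 = p'`_4 by move: ll; rewrite /lead_coef p5 p5'.
apply/polyP => -[|[|[|[|[|i]]]]] //.
by rewrite !nth_default ?p5 ?p5'.
Qed.

Lemma Aset_quartic_code (z : C) : Aset 2 4 (powR h (4%:R)^-1) z ->
  exists (e : bool) (y : int) (p : {poly int}) (rs : seq C),
    [/\ quartic_code e y p, `|y| <= (10 * b)%:Z & -4 <= slot y p < 4] /\
    [/\ size rs = 4%N, polyZC R p = (lead_coef p)%:~R *: \prod_(r <- rs) ('X - r%:P) &
        z \in rs].
Proof.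
move=> [p [rs [[[pz [p_irr p1]] pE] [rs4 [rs2 hE]]]]].
have l_gt0 := zcontents1_lead p1.
have p_neq0 : p != 0 by rewrite -lead_coef_eq0 gt_eqF.
have [U1 [W1 [U2 [W2 [pR [prodE [nW1 nW2 nU1 nU2]]]]]]] := conjugates_split p_neq0 pE rs4 rs2.
have l0 : 0 < (lead_coef p)%:~R :> R by rewrite ltr0z.
have bs2 := bs_ge2; have hlb := height_lb; have hub := height_ub.
have {}hE : h = (lead_coef p)%:~R * `|W1|.
  apply: powR_fourth_root_inj; rewrite ?hE ?prodE //; last by rewrite mulr_ge0 // ltW.
  lra.
(* Equality of heights reads [lead_coef p * |W1| = h], so only the sign of [W1] is free. *)
have [e W1E] : exists e : bool, (lead_coef p)%:~R * W1 =
    ((-1) ^+ e * a)%:~R + ((-1) ^+ e * b%:Z)%:~R * s.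
  exists (W1 < 0); rewrite !rmorphM rmorph_sign /= -mulrA -mulrDr.
  by rewrite [X in _ = _ * X]hE mulrCA [in LHS](numEsign W1).
have [p5 [y [yU1 yU2 p2 p1' p0]]] :=
  irreducible_quartic_coefs q_pr q_odd s_sqr p_irr (lt0r_neq0 l_gt0) pR nW1 nW2 W1E.
exists e, y, p, rs; split; split=> //.
- split=> //; rewrite p0 !exprMn -!exprM mulnC !exprM sqrrN expr1n; ring.
(* With leading coefficient [a0 <= h], [|y| s = a0 |U1 - U2| <= a0 (2 |W1| + 2) <= 4h], and
   [4h <= 8 b s + 4 <= 10 b s] because [b s >= 2]. *)
- have s2 := sqrt_2prime_ge2 q_pr q_odd s_ge0 s_sqr.
  have ysE : y%:~R * s = (lead_coef p)%:~R * (U1 - U2).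
    by move: yU1 yU2; rewrite !rmorphM /=; lra.
  have l_le : (lead_coef p)%:~R <= h by rewrite hE ler_peMr // ltW.
  have ys_le : `|y|%:~R * s <= 4 * h.
    rewrite intr_norm -{1}(ger0_norm s_ge0) -normrM ysE normrM gtr0_norm //.
    apply: (@le_trans _ _ ((lead_coef p)%:~R * (2 * `|W1| + 2))); last by lra.
    by rewrite ler_pM2l // (le_trans (ler_normB _ _)) // lerD // ltW.
  have b1 : 1 <= b%:R :> R by rewrite ler1n.
  have b10 : (10 * b)%:Z%:~R = 10 * b%:R :> R by rewrite -[LHS]/((10 * b)%:R) natrM.
  rewrite -(@ler_int R) b10 -(@ler_pM2r _ s); last lra.
  by nra.
(* The slot is the floor of [2 * U2], and [|U2| < 2]. *)
- rewrite /slot floor_ge_int floor_lt_int.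
  have -> : - (p`_3)%:~R - y%:~R * s = (lead_coef p)%:~R * (2 * U2).
    by move: yU2; rewrite !(rmorphM, rmorphN) /=; lra.
  rewrite mulrAC mulfV ?mul1r ?gt_eqF //; move: nU2; rewrite ltr_norml => /andP[? ?].
  by apply/andP; split; lra.
- by move: pz; rewrite pE rootZ ?root_prod_XsubC // intr_eq0 gt_eqF.
Qed.

Local Notation n := (a ^+ 2 - (2 * q)%:Z * b%:Z ^+ 2).

Lemma norm_neq0 : n != 0.
Proof.
apply/negP => /eqP/subr0_eq/(congr1 absz); rewrite !(abszX, abszM) !absz_nat.
by move/(sqr_eq_2prime_sqr q_pr q_odd) => b0; move: b_gt0; rewrite b0.
Qed.

(** The factors of the bound count the roots of one quartic (4), the leading coefficients, the signs
    (2), the values of [y] and the slots (8). *)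
Lemma Aset_cover : exists zs : seq C,
  (size zs <= 4 * (size (divisors `|(n)%R|%N) * 2 * ((20 * b).+1 * 8)))%N /\
  forall z, Aset 2 4 (powR h (4%:R)^-1) z -> z \in zs.
Proof.
pose code (c : (nat * bool) * (nat * nat)) (p : {poly int}) :=
  exists y : int, [/\ quartic_code c.1.2 y p, `|y| <= (10 * b)%:Z,
    -4 <= slot y p < 4, c.1.1 = `|lead_coef p|%N &
    c.2 = (`|(y + (10 * b)%:Z)%R|%N, `|(slot y p + 4)%R|%N)].
(* Shifting [y] by [10 * b] and the slot by 4 makes both natural numbers. *)
pose cs := [seq (u, v) | u <- [seq (d, e) | d <- divisors `|(n)%R|%N, e <- [:: true; false]],
                         v <- [seq (i, j) | i <- iota 0 (20 * b).+1, j <- iota 0 8]].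
have code_inj c p p' : code c p -> code c p' -> p = p'.
  case: c => -[d e] [i j] [y [/= c1 y1 k1 -> [-> ->]]] [y' [/= c2 y2 k2 ll [yy kk]]].
  have yE : y' = y by move: y1 y2 yy; clear; lia.
  rewrite yE in c2 k2 kk.
  apply: (quartic_code_inj c1 c2); last by move: k1 k2 kk; clear; lia.
  by case: c1 c2 ll => [l1 _ _ _ _] [l2 _ _ _ _]; move: l1 l2; clear; lia.
have [ps [sps psP]] := seq_of_codes (0 : {poly int}) cs code_inj.
pose good p := [set rs : seq C | size rs = 4%N /\
  polyZC R p = (lead_coef p)%:~R *: \prod_(r <- rs) ('X - r%:P)].
exists (flatten [seq xget [::] (good p) | p <- ps]); split.
  apply: (@leq_trans (4 * size ps)).
    by apply: size_flatten_map_le => p; case: xgetP => [rs -> [->]|].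
  by rewrite sps !size_allpairs !size_iota.
move=> z /Aset_quartic_code [e [y [p [rs [[cp yb kb] [rs4 pE zrs]]]]]].
have [l_gt0 _ _ _ p0] := cp.
have p_ps : p \in ps.
  apply: (psP ((`|lead_coef p|%N, e), (`|(y + (10 * b)%:Z)%R|%N, `|(slot y p + 4)%R|%N))).
    apply: allpairs_f; apply: allpairs_f; rewrite ?mem_iota.
    - rewrite -dvdn_divisors ?absz_gt0 ?norm_neq0 // -p0 abszM dvdn_mulr //.
    - by case: (e).
    - by move: yb; clear; lia.
    - by move: kb; clear; lia.
  by exists y.
apply/flattenP; exists (xget [::] (good p)); first by apply/mapP; exists p.
(* The chosen list may order the roots differently from [rs], but both list all roots of [p]. *)
have [rs4' pE'] : good p (xget [::] (good p)) by apply: xgetPex; exists rs.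
have : root (polyZC R p) z.
  by rewrite pE rootZ ?root_prod_XsubC // intr_eq0 gt_eqF.
by rewrite {1}pE' rootZ ?root_prod_XsubC // intr_eq0 gt_eqF.
Qed.

End UpperBound.

(** * Lower bound: locating the roots of a family of quartics *)

Section QuadraticRoots.
Variable R : realType.
Local Notation C := (complex R).
Local Notation RC := (real_complex_def (Phant R)).

Lemma quad_split (u w : C) : exists y z : C, y + z = u /\ y * z = w.
Proof.
have [rs] := closed_field_poly_normal (quad u w).
rewrite (eqP (monic_quad u w)) scale1r => rsE.
have := size_quad u w; rewrite rsE size_prod_XsubC.
case: rs rsE => [|y [|z []]] //; rewrite !big_cons big_nil => rsE _.
by exists y, z; apply: quad_inj; rewrite rsE -quad_roots (mulr1 ('X - z%:P)).
Qed.

Lemma sqr_cabs (z : C) : cabs z ^+ 2 = complex.Re z ^+ 2 + complex.Im z ^+ 2.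
Proof. by apply: complexI; rewrite rmorphXn /= -normc_cabs add_Re2_Im2. Qed.

(** A nonreal root satisfies [|z|^2 = w < 1]. For a real one with [|z| >= 1], [z^2 - u z >= 0] and
    the quadratic would be at least [w > 0]. *)
Lemma quad_root_cabs_lt1 (u w : R) (z : C) :
  z ^+ 2 - RC u * z + RC w = 0 -> `|u| <= 1 -> 0 < w < 1 -> cabs z < 1.
Proof.
move=> ze u1 /andP[w0 w1]; rewrite ltNge; apply/negP => z1.
have : 1 <= cabs z ^+ 2 by rewrite exprn_ege1.
rewrite sqr_cabs; case: z ze {z1} => x y /eqP.
rewrite eq_complex /= => /andP[/eqP re /eqP im] xy.
have {}im : y * (2 * x - u) = 0 by lra.
have {}re : x ^+ 2 - y ^+ 2 - u * x + w = 0 by lra.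
move/eqP: im; rewrite mulf_eq0 => /orP[/eqP y0|/eqP ux]; last by nra.
have x1 : 1 <= `|x|.
  by rewrite -(@ler_pXn2r _ 2) ?nnegrE // expr1n real_normK ?num_real // ; nra.
have : u * x <= `|x| ^+ 2.
  apply: (le_trans (ler_norm _)); rewrite normrM expr2 ler_wpM2r //.
  exact: le_trans u1 x1.
by rewrite real_normK ?num_real //; move: re; rewrite y0; nra.
Qed.

(** If [|z| < 1], then [|w| = |u z - z^2| < |u| + 1]. *)
Lemma quad_root_cabs_ge1 (u w : R) (z : C) :
  z ^+ 2 - RC u * z + RC w = 0 -> `|u| <= `|w| - 1 -> 1 <= cabs z.
Proof.
move=> ze uw; rewrite leNgt; apply/negP => z1.
have : RC w = RC u * z - z * z by rewrite -[LHS]subr0 -ze; ring.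
move/(congr1 (@cabs R)); rewrite cabs_real => wE.
have := cabsD (RC u * z) (- (z * z)); rewrite -wE cabsN !cabsM cabs_real.
have z0 := cabs_ge0 z; have u0 := normr_ge0 u; nra.
Qed.

End QuadraticRoots.

Section QuarticPolynomial.

(** For [s^2 = D] this is the product of [t^2 - (x + y s) t + (A + B s)] with its conjugate over
    [Q(s)]. *)
Definition quartic (D A B x y : int) : {poly int} :=
  \poly_(i < 5) nth 0 [:: A ^+ 2 - D * B ^+ 2; - (2 * (x * A - D * y * B));
    2 * A + x ^+ 2 - D * y ^+ 2; - (2 * x); 1] i.

Lemma coef_quartic D A B x y i : (quartic D A B x y)`_i =
  nth 0 [:: A ^+ 2 - D * B ^+ 2; - (2 * (x * A - D * y * B));
    2 * A + x ^+ 2 - D * y ^+ 2; - (2 * x); 1] i.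
Proof. by rewrite coef_poly; case: ltnP => // i5; rewrite nth_default. Qed.

Lemma size_quartic D A B x y : size (quartic D A B x y) = 5%N.
Proof. exact: size_poly_eq. Qed.

Lemma lead_coef_quartic D A B x y : lead_coef (quartic D A B x y) = 1.
Proof. by rewrite /lead_coef size_quartic coef_quartic. Qed.

Lemma quartic_factor (R : realType) (s : R) (D A B x y : int) : s ^+ 2 = D%:~R ->
  polyZR R (quartic D A B x y) =
    quad (x%:~R + y%:~R * s) (A%:~R + B%:~R * s) *
    quad (x%:~R - y%:~R * s) (A%:~R - B%:~R * s).
Proof.
move=> sD; apply/polyP => i; rewrite coef_polyZR coef_quartic coef_quad_mul.
case: i => [|[|[|[|[|i]]]]] //=;
  rewrite ?nth_nil // ?(rmorphXn, rmorphM, rmorphD, rmorphN) /= -?sD; ring.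
Qed.

Lemma irreducible_quartic (q A B x y : int) :
  irreducible_poly (map_poly (fun z : int => z%:~R : rat)
    (quartic (2 * (2 * q + 1)) (2 * A + 1) (2 * B) (2 * x + 1) (2 * y + 1))).
Proof.
set D := 2 * (2 * q + 1).
apply: (@irreducible_quartic_mod4 _ (A ^+ 2 + A - D * B ^+ 2)
  (- ((2 * x + 1) * (2 * A + 1) - D * (2 * y + 1) * (2 * B)))
  (A + x ^+ 2 + x - D * (y ^+ 2 + y) - q) (- x - 1));
  rewrite ?size_quartic ?coef_quartic //= /D; ring.
Qed.

(** This makes roots chosen from different quartics of the family distinct. *)
Lemma root_irreducible_inj (R : realType) (p p' : {poly int}) (z : complex R) :
  p \is monic -> p' \is monic -> size p = size p' ->
  irreducible_poly (map_poly (fun x : int => x%:~R : rat) p) ->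
  root (polyZC R p) z -> root (polyZC R p') z -> p = p'.
Proof.
move=> pm pm' pp' p_irr pz pz'.
set f := map_poly _ p in p_irr; set f' := map_poly (fun x : int => x%:~R : rat) p'.
have ratrE (g : {poly int}) :
    polyZC R g = map_poly ratr (map_poly (fun x : int => x%:~R : rat) g).
  by rewrite -map_poly_comp; apply: eq_map_poly => x /=; rewrite ratr_int.
have : ~~ coprimep f f'.
  rewrite -(coprimep_map (ratr : {rmorphism rat -> complex R})) -!ratrE.
  by apply/negP => /coprimep_root/(_ pz); rewrite rootE in pz'; rewrite (eqP pz') eqxx.
rewrite (irreducible_poly_coprime _ p_irr) negbK => ff'.
have fm : f \is monic by exact: monic_map.
have fm' : f' \is monic by exact: monic_map.
have : f %= f' by rewrite -dvdp_size_eqp // !size_map_inj_poly ?pp' //; exact: intr_inj.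
rewrite eqp_monic // => /eqP.
by apply: map_inj_poly => //; exact: intr_inj.
Qed.

End QuarticPolynomial.

Section LowerBound.
Variables (R : realType) (q : nat) (s : R) (a : int) (b : nat).
Hypotheses (q_pr : prime q) (q_odd : odd q).
Hypotheses (s_ge0 : 0 <= s) (s_sqr : s ^+ 2 = (2 * q)%:R) (b_gt0 : (0 < b)%N).
Hypotheses (near : `|a%:~R - b%:R * s| < 1).
Hypotheses (a_odd : exists k : int, a = 2 * k + 1) (b_even : ~~ odd b).
Local Notation C := (complex R).
Local Notation RC := (real_complex_def (Phant R)).
Local Notation h := (a%:~R + b%:R * s).
Local Notation sgn e := ((-1) ^+ nat_of_bool e).

Lemma Aset_quartic (e : bool) (m : nat) (x : int) : e = (a%:~R - b%:R * s < 0) ->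
  (2 * m < b)%N ->
  (2 * x + 1)%:~R - 1 <= (2 * m + 1)%:Z%:~R * s < (2 * x + 1)%:~R + 1 ->
  let p := quartic (2 * q)%:Z (sgn e * a) (sgn e * b%:Z) (2 * x + 1) (2 * m + 1)%:Z in
  irreducible_poly (map_poly (fun z : int => z%:~R : rat) p) /\
  exists z : C, Aset 2 4 (powR h (4%:R)^-1) z /\ root (polyZC R p) z.
Proof.
move=> eE mb /andP[x1 x2] p.
have bs2 := bs_ge2 q_pr q_odd s_ge0 s_sqr b_gt0.
have hlb := height_lb near; have hub := height_ub near.
have s2 := sqrt_2prime_ge2 q_pr q_odd s_ge0 s_sqr.
have p_irr : irreducible_poly (map_poly (fun z : int => z%:~R : rat) p).
  have [A AE] : exists A : int, sgn e * a = 2 * A + 1.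
    by case: a_odd => k ->; case: (e); [exists (- k - 1)|exists k]; rewrite /=; ring.
  have [B BE] : exists B : int, sgn e * b%:Z = 2 * B.
    exists (sgn e * (b./2)%:Z); rewrite mulrCA; congr (_ * _).
    by rewrite -[in LHS](odd_double_half b) (negPf b_even) add0n; clear; lia.
  have [t tE] : exists t : int, (2 * q)%:Z = 2 * (2 * t + 1).
    exists (q./2)%:Z; rewrite -[in LHS](odd_double_half q) q_odd; clear; lia.
  have mE : (2 * m + 1)%:Z = 2 * m%:Z + 1 by clear; lia.
  by rewrite /p AE BE tE mE; exact: irreducible_quartic.
have lead1 : lead_coef p = 1 by exact: lead_coef_quartic.
have nab_neq0 : a%:~R - b%:R * s != 0.
  apply/negP => /eqP/subr0_eq; rewrite -[b%:R]/(b%:~R) => /(sqrt_2prime_irr q_pr q_odd s_sqr).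
  by move=> b0; move: b_gt0; rewrite -ltz_nat b0.
pose A : R := (sgn e * a)%:~R; pose B : R := (sgn e * b%:Z)%:~R.
pose X : R := (2 * x + 1)%:~R; pose Y : R := (2 * m + 1)%:~R.
have ABh : A + B * s = sgn e * h.
  by rewrite /A /B !rmorphM !rmorphXn !rmorphN /= -mulrA -mulrDr.
(* The sign [e] is chosen so that the product of the inner roots is positive, as
   [quad_root_cabs_lt1] requires. *)
have ABh' : A - B * s = `|a%:~R - b%:R * s|.
  have -> : A - B * s = sgn e * (a%:~R - b%:R * s).
    by rewrite /A /B !rmorphM !rmorphXn !rmorphN /= -mulrA -mulrBr.
  by rewrite [X in _ * X]numEsign -eE mulrA -expr2 sqrr_sign mul1r.
have pR : polyZR R p = quad (X + Y * s) (A + B * s) * quad (X - Y * s) (A - B * s).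
  by apply: quartic_factor; rewrite s_sqr.
have [z1 [z2 [zS zP]]] := quad_split (RC (X + Y * s)) (RC (A + B * s)).
have [w1 [w2 [wS wP]]] := quad_split (RC (X - Y * s)) (RC (A - B * s)).
have pC : polyZC R p = \prod_(r <- [:: z1; z2; w1; w2]) ('X - r%:P).
  rewrite polyZC_polyZR pR rmorphM /= !map_quad /= -zS -zP -wS -wP -!quad_roots.
  by rewrite !big_cons big_nil (mulr1 ('X - w2%:P)) !mulrA.
have nAB : `|A + B * s| = h by rewrite ABh normrM normr_sign mul1r ger0_norm; lra.
have outer z : z ^+ 2 - (z1 + z2) * z + z1 * z2 = 0 -> 1 <= cabs z.
  rewrite zS zP => /quad_root_cabs_ge1; apply; rewrite nAB.
  (* As [b] is even, [2 * m < b] gives [2 * m + 1 <= b - 1]. Then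
     [|X + Y s| <= 2 (b - 1) s + 1 <= h - 1], by [s >= 2] and [h > 2 b s - 1]. *)
  have Yb : Y <= b%:R - 1.
    rewrite /Y lerBrDr -[b%:R]/(b%:~R) -[1]/(1%:~R) -rmorphD ler_int.
    by move: mb b_even; clear; lia.
  have Y1 : 1 <= Y by rewrite /Y ler1z; clear; lia.
  rewrite ler_norml; apply/andP; move: x1 x2; rewrite -/X -/Y => x1 x2.
  by split; nra.
have inner z : z ^+ 2 - (w1 + w2) * z + w1 * w2 = 0 -> cabs z < 1.
  rewrite wS wP => /quad_root_cabs_lt1; apply; last by rewrite ABh' normr_gt0 nab_neq0.
  by rewrite ler_norml /X /Y; apply/andP; split; move: x1 x2; lra.
have z1_ge : 1 <= cabs z1 by apply: outer; ring.
have z2_ge : 1 <= cabs z2 by apply: outer; ring.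
have w1_lt : cabs w1 < 1 by apply: inner; ring.
have w2_lt : cabs w2 < 1 by apply: inner; ring.
have pz1 : root (polyZC R p) z1 by rewrite pC root_prod_XsubC inE eqxx.
split=> //; exists z1; split=> //; exists p, [:: z1; z2; w1; w2]; split.
  split; last by rewrite lead1 scale1r.
  by split=> //; split=> //; rewrite zcontents_monic // monicE lead1.
split=> //; split.
  by rewrite /= w1_lt w2_lt !ltNge z1_ge z2_ge.
rewrite lead1 mul1r !big_cons big_nil (max_r z1_ge) (max_r z2_ge).
by rewrite (max_l (ltW w1_lt)) (max_l (ltW w2_lt)) !mulr1 -cabsM zP cabs_real nAB.
Qed.

End LowerBound.

(** * Counting the numbers of a given height *)

Lemma horner_quad (T : comNzRingType) (u w x : T) :
  (quad u w).[x] = x ^+ 2 - u * x + w.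
Proof. by rewrite /quad hornerD hornerC hornerD hornerN hornerZ hornerXn hornerX. Qed.

Lemma card_bounds (T : choiceType) (S : set T) (zs ws : seq T) :
  (forall z, S z -> z \in zs) -> uniq ws -> (forall z, z \in ws -> S z) ->
  exists N : nat, [/\ (S #= `I_N)%card, (size ws <= N)%N & (N <= size zs)%N].
Proof.
move=> Szs ws_uniq wsS.
have Sfin : finite_set S by apply: (sub_finite_set _ (finite_seq zs)) => z /Szs.
have [N SN] := (finite_setP S).1 Sfin.
exists N; split=> //; rewrite -(card_fset_set SN).
- apply: uniq_leq_size ws_uniq _ => z /wsS Sz.
  by rewrite (in_fset_set Sfin) inE.
- apply: uniq_leq_size; first exact: finmap.fset_uniq.
  by move=> z; rewrite (in_fset_set Sfin) inE; exact: Szs.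
Qed.

Section Counting.
Variables (R : realType) (q : nat) (s : R) (a : int) (b : nat).
Hypotheses (q_pr : prime q) (q_odd : odd q).
Hypotheses (s_ge0 : 0 <= s) (s_sqr : s ^+ 2 = (2 * q)%:R) (b_gt0 : (0 < b)%N).
Hypotheses (near : `|a%:~R - b%:R * s| < 1).
Hypotheses (cop : coprimez a ((2 * q)%:Z * b%:Z ^+ 2)).
Hypotheses (a_odd : exists k : int, a = 2 * k + 1) (b_even : ~~ odd b).
Local Notation C := (complex R).
Local Notation RC := (real_complex_def (Phant R)).
Local Notation h := (a%:~R + b%:R * s).
Local Notation n := (a ^+ 2 - (2 * q)%:Z * b%:Z ^+ 2).

Lemma intr_norm_form (T : nzRingType) :
  n%:~R = a%:~R ^+ 2 - (2 * q)%:R * b%:R ^+ 2 :> T.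
Proof. by rewrite intrB intrM !rmorphXn. Qed.

Lemma alg_degree_height : alg_degree (RC h) 2.
Proof.
exists (quad (2 * a) n); split; last exact: size_quad.
have mapE (T : nzRingType) : map_poly (fun z : int => z%:~R : T) (quad (2 * a) n) =
    quad (2 * a)%:~R n%:~R by exact: map_quad.
split; last split; last by rewrite zcontents_monic ?monic_quad.
- rewrite /polyZC mapE rootE horner_quad.
  have hC : RC h = a%:~R + b%:R * RC s by rewrite rmorphD rmorphM rmorph_int rmorph_nat.
  have sC : (2 * q)%:R = RC s ^+ 2 by rewrite -rmorphXn s_sqr rmorph_nat.
  by rewrite intr_norm_form sC hC intrM; apply/eqP; ring.
(* In degree 2 it suffices to exclude a rational root [r]; one would give [(r - a)^2 = 2q b^2],
   making [s] rational. *)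
rewrite mapE; apply: cubic_irreducible; first by rewrite size_quad.
move=> r; apply/negP; rewrite rootE horner_quad => /eqP re.
have rE : (r - a%:~R) ^+ 2 = (2 * q)%:R * b%:R ^+ 2.
  apply/eqP; rewrite -subr_eq0 -[X in _ == X]re; apply/eqP.
  by rewrite intr_norm_form intrM; ring.
have : (ratr (r - a%:~R) + ratr (- b%:R) * s) * (ratr (r - a%:~R) + ratr b%:R * s) = 0.
  have : ratr (r - a%:~R) ^+ 2 = s ^+ 2 * ratr b%:R ^+ 2 :> R.
    by rewrite -(ratr_2prime s_sqr) -rmorphXn -[X in _ * X]rmorphXn -rmorphM rE.
  move: (r - a%:~R) => t tE; rewrite rmorphN /= mulrC.
  by rewrite -[RHS](subrr (ratr t ^+ 2)) {2}tE; ring.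
move/eqP; rewrite mulf_eq0 => /orP[] /eqP /(sqrt_2prime_ratr q_pr q_odd s_sqr) [_ /eqP];
  rewrite ?oppr_eq0 pnatr_eq0 => /eqP b0; by move: b_gt0; rewrite b0.
Qed.

(** The norm is [h] times its conjugate, whose absolute value is less than 1. *)
Lemma norm_le_height : (`|(n)%R|%N)%:R <= h.
Proof.
have bs2 := bs_ge2 q_pr q_odd s_ge0 s_sqr b_gt0; have hlb := height_lb near.
have nE : n%:~R = h * (a%:~R - b%:R * s).
  by rewrite intr_norm_form -s_sqr; ring.
rewrite natr_absz intr_norm nE normrM ger0_norm; last by lra.
by rewrite ler_piMr ?(ltW near) //; lra.
Qed.

Lemma Aset_count : exists N : nat,
  [/\ Bset 2 4 (powR h (4%:R)^-1), (Aset 2 4 (powR h (4%:R)^-1) #= `I_N)%card,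
      (b <= 2 * N)%N & (N <= 1344 * (b * size (divisors `|(n)%R|)))%N].
Proof.
have [zs [zs_size zsP]] := Aset_cover q_pr q_odd s_ge0 s_sqr b_gt0 near cop.
pose e := a%:~R - b%:R * s < 0.
pose f x m := quartic (2 * q)%:Z ((-1) ^+ nat_of_bool e * a)
  ((-1) ^+ nat_of_bool e * b%:Z) (2 * x + 1) (2 * m + 1)%:Z.
(* The bound on [m] sits inside the existential so that the choice is total in [m]; outside the
   range it is the dummy [(0, 0)]. *)
have ex m : {xz : int * C | (2 * m < b)%N ->
   [/\ (2 * xz.1 + 1)%:~R - 1 <= (2 * m + 1)%:Z%:~R * s < (2 * xz.1 + 1)%:~R + 1,
       irreducible_poly (map_poly (fun z : int => z%:~R : rat) (f xz.1 m)),
       Aset 2 4 (powR h (4%:R)^-1) xz.2 & root (polyZC R (f xz.1 m)) xz.2]}.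
  apply: cid; have [x xP] := exists_odd_near ((2 * m + 1)%:Z%:~R * s).
  have [mb|mb] := boolP (2 * m < b)%N; last by exists (0, 0).
  have [p_irr [z [zA pz]]] :=
    Aset_quartic q_pr q_odd s_ge0 s_sqr b_gt0 near a_odd b_even (erefl e) mb xP.
  by exists (x, z).
pose x m := (sval (ex m)).1; pose z m := (sval (ex m)).2.
have zP m (mb : (2 * m < b)%N) := svalP (ex m) mb.
pose ws := [seq z m | m <- iota 0 b./2].
have mb m : m \in iota 0 b./2 -> (2 * m < b)%N.
  by rewrite mem_iota; move: b_even; clear; lia.
have ws_uniq : uniq ws.
  rewrite map_inj_in_uniq ?iota_uniq // => m m' /mb/zP[xm f_irr _ fz] /mb/zP[xm' _ _ fz'].
  rewrite -/(x m) -/(z m) -/(x m') -/(z m') in xm f_irr fz xm' fz' * => zz.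
  have ff : f (x m) m = f (x m') m'.
    apply: root_irreducible_inj f_irr fz _; rewrite ?monicE ?lead_coef_quartic //.
      by rewrite !size_quartic.
    by rewrite zz.
  have xx : x m = x m'.
    have := congr1 (fun p : {poly int} => p`_3) ff; rewrite !coef_quartic /=.
    by clear; lia.
  have s2 := sqrt_2prime_ge2 q_pr q_odd s_ge0 s_sqr.
  (* Distinct odd multiples of [s] are at least [2 s >= 4] apart, too far to share a half-open
     window of length 2 around the same odd integer. *)
  have lt_absurd k k' : (k < k')%N -> (2 * k + 1)%:Z%:~R * s <= (2 * k' + 1)%:Z%:~R * s - 2.
    move=> kk; have : (2 * k + 1)%:Z%:~R + 2 <= (2 * k' + 1)%:Z%:~R :> R.
      by rewrite -[2]/(2%:~R) -rmorphD ler_int; move: kk; clear; lia.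
    by nra.
  have le k k' (X : R) : X - 1 <= (2 * k + 1)%:Z%:~R * s ->
      (2 * k' + 1)%:Z%:~R * s < X + 1 -> (k' <= k)%N.
    move=> l1 l2; rewrite leqNgt; apply/negP => /lt_absurd l3.
    have : (0 : R) < 0 by lra.
    by rewrite ltxx.
  move: xm xm'; rewrite xx => /andP[? ?] /andP[? ?]; apply/eqP; rewrite eqn_leq.
  by apply/andP; split; apply: le; eassumption.
have wsA w : w \in ws -> Aset 2 4 (powR h (4%:R)^-1) w.
  by move=> /mapP[m /mb/zP[_ _ zA _] ->].
have [N [N1 N2 N3]] := card_bounds zsP ws_uniq wsA.
exists N; split=> //.
- exists (z 0%N); by case: (zP 0%N); rewrite ?muln0.
- by move: N2; rewrite size_map size_iota; move: b_even; clear; lia.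
(* The constant is [1344 = 4 * 2 * 8 * 21], with [20 b + 1 <= 21 b]. *)
- apply: (leq_trans N3); apply: (leq_trans zs_size).
  by move: b_gt0 (size _); clear; nia.
Qed.

End Counting.

(** * Choice of parameters and passage to the limit *)

Lemma size_divisors_gt0 (n : nat) : (0 < size (divisors n))%N.
Proof. by have := divisor1 n; case: (divisors n). Qed.

Lemma ln_le_homo (R : realType) (x y : R) : 0 < x -> x <= y -> ln x <= ln y.
Proof. by move=> x0 xy; rewrite ler_ln ?posrE // (lt_le_trans x0). Qed.

(* The parameters q and j make the heights h of size exp T with b = 2 ^ i of
   size exp (theta T). *)
Lemma exists_prime_scale (R : realType) (theta : R) (n : nat) : 0 <= theta <= 1 ->
  exists (q : nat) (T : R), [/\ prime q, odd q, n%:R * (ln 2 / 2) <= T &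
    `|ln q%:R / 2 - (1 - theta) * T| <= ln 3].
Proof.
move=> /andP[t0 t1]; have ln3 : 0 <= ln (3 : R) by rewrite ln_ge0 // ler1n.
have ln2 : 0 <= ln (2 : R) by rewrite ln_ge0 // ler1n.
have [t_lt|t_ge] := ltP theta 1; last first.
  (* For [theta = 1] the prime stays bounded and [T] is free. *)
  exists 3, (n%:R * (ln 2 / 2)); split=> //.
  have -> : theta = 1 by apply/le_anti/andP.
  by rewrite subrr mul0r subr0 ger0_norm; lra.
(* Here [T] solves [ln q / 2 = (1 - theta) T] exactly. The exponent [n + 1] rules out [q = 2]. *)
have [q q_gt q_pr] := prime_above (2 ^ n.+1).
have q2n : (2 ^ n <= q)%N by rewrite ltnW // (leq_ltn_trans _ q_gt) // leq_exp2l.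
have lnq : n%:R * ln 2 <= ln q%:R :> R.
  by rewrite mulr_natl -lnXn // ln_le_homo ?exprn_gt0 // -natrX ler_nat.
have nln2 : 0 <= n%:R * ln 2 :> R by rewrite mulr_ge0.
exists q, (ln q%:R / 2 / (1 - theta)); split=> //.
- have [q2|//] := even_prime q_pr.
  by move: q_gt; rewrite q2 expnS; have := expn_gt0 2 n; clear; lia.
- apply: (@le_trans _ _ (ln q%:R / 2)); first by lra.
  by rewrite ler_pdivlMr ?subr_gt0 // ler_piMr; lra.
- by rewrite mulrCA mulfV ?mulr1 ?subrr ?normr0 // subr_eq0 gt_eqF.
Qed.

(** Up to bounded errors, [ln h] is [ln b + ln s], where [ln b] is [theta T] and [ln s] is
    [(1 - theta) T]. *)
Lemma exists_height_scale (R : realType) (theta : R) (n : nat) : 0 <= theta <= 1 ->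
  exists (h T : R) (N m : nat),
    [/\ 1 <= h, Bset 2 4 (powR h (4%:R)^-1),
        alg_degree (complex.real_complex_def (Phant R) h) 2 &
        (Aset 2 4 (powR h (4%:R)^-1) #= `I_N)%card] /\
    [/\ n%:R * (ln 2 / 2) <= T, `|ln h - T| <= 3 * ln 2 + 2 * ln 3,
        theta * T - ln 2 <= ln N%:R,
        ln N%:R <= ln 1344 + (theta * T + 2 * ln 2) + ln (size (divisors m))%:R &
        (0 < m)%N /\ m%:R <= h].
Proof.
move=> t01; have [q [T [q_pr q_odd Tn qT]]] := exists_prime_scale n t01.
have ln2 : 0 < ln (2 : R) by rewrite ln_gt0 // ltr1n.
have ln3 : 0 < ln (3 : R) by rewrite ln_gt0 // ltr1n.
have T_ge0 : 0 <= T by apply: le_trans Tn; rewrite mulr_ge0 ?divr_ge0 ?(ltW ln2).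
have /andP[t0 t1] := t01.
pose s : R := Num.sqrt (2 * q)%:R.
have s_ge0 : 0 <= s := sqrtr_ge0 _.
have s_sqr : s ^+ 2 = (2 * q)%:R by rewrite sqr_sqrtr.
(* The successor gives [2^j >= exp (theta T)] and also [i >= 1], so that [b = 2^i] is even;
   [i <= j + 1] loses at most a factor 4. *)
pose j := (Num.trunc (theta * T / ln 2)).+1.
have /andP[j1 j2] := truncn_itv (divr_ge0 (mulr_ge0 t0 T_ge0) (ltW ln2)).
have [i [a [/andP[ji ij] cop a_odd near]]] :=
  exists_coprime_near_sqrt q_pr q_odd s_ge0 s_sqr j.
have b_gt0 : (0 < 2 ^ i)%N by rewrite expn_gt0.
have b_even : ~~ odd (2 ^ i) by rewrite oddX /= orbF -lt0n (leq_trans _ ji).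
have bs2 := bs_ge2 q_pr q_odd s_ge0 s_sqr b_gt0.
have hlb := height_lb near; have hub := height_ub near.
have nh := norm_le_height q_pr q_odd s_ge0 s_sqr b_gt0 near.
have hdeg := alg_degree_height a q_pr q_odd s_sqr b_gt0.
have n_neq0 := norm_neq0 a q_pr q_odd b_gt0.
have [N [HB HN Nlb Nub]] := Aset_count q_pr q_odd s_ge0 s_sqr b_gt0 near cop a_odd b_even.
have s2 := sqrt_2prime_ge2 q_pr q_odd s_ge0 s_sqr.
set h := a%:~R + _ in hlb hub nh hdeg HB HN *.
move: n_neq0 nh Nub; set m := _ - _ => m_neq0 nh Nub.
have lnb : ln (2 ^ i)%:R = i%:R * ln 2 :> R by rewrite natrX lnXn // mulr_natl.
have lnbT : theta * T <= ln (2 ^ i)%:R <= theta * T + 2 * ln 2.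
  have ji' : j%:R * ln 2 <= i%:R * ln 2 :> R by rewrite ler_pM2r // ler_nat.
  have ij' : i%:R * ln 2 <= (j%:R + 1) * ln 2 :> R by rewrite ler_pM2r // natr1 ler_nat.
  move: j1 j2; rewrite -natr1 ler_pdivlMr // ltr_pdivrMr // lnb => j1 j2.
  have jE : j%:R = (Num.trunc (theta * T / ln 2))%:R + 1 :> R by rewrite natr1.
  by rewrite jE in ji' ij' j2; apply/andP; split; lra.
have s_gt0 : 0 < s by lra.
have lns : ln s = (ln 2 + ln q%:R) / 2.
  have : ln (s ^+ 2) = ln 2 + ln q%:R.
    by rewrite s_sqr natrM lnM ?posrE ?ltr0n // prime_gt0.
  by rewrite lnXn // mulr2n; lra.
have b_gt0' : 0 < (2 ^ i)%:R :> R by rewrite ltr0n.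
have lnbs : ln ((2 ^ i)%:R * s) = ln (2 ^ i)%:R + ln s by rewrite lnM ?posrE.
have h_lb : ln (2 ^ i)%:R + ln s <= ln h by rewrite -lnbs ln_le_homo; lra.
have h_ub : ln h <= ln 3 + (ln (2 ^ i)%:R + ln s).
  by rewrite -lnbs -lnM ?posrE //; [rewrite ln_le_homo; lra | lra].
have N_gt0 : (0 < N)%N.
  by rewrite lt0n; apply/eqP => N0; move: Nlb b_gt0; rewrite N0 muln0 leqn0 => /eqP ->.
have d_gt0 := size_divisors_gt0 `|m|%N.
exists h, T, N, `|m|%N; split; split=> //.
- lra.
- by move: qT lnbT; rewrite !ler_norml => /andP[? ?] /andP[? ?]; apply/andP; split; lra.
- have : ln (2 ^ i)%:R <= ln 2 + ln N%:R :> R.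
    by rewrite -lnM ?posrE ?ltr0n // ln_le_homo // -natrM ler_nat.
  lra.
- have : ln N%:R <= ln (1344 * ((2 ^ i)%:R * (size (divisors `|m|%N))%:R)) :> R.
    by rewrite ln_le_homo ?ltr0n // -!natrM ler_nat.
  by rewrite !lnM ?posrE ?mulr_gt0 ?ltr0n //; lra.
- by rewrite absz_gt0.
Qed.

Lemma cvg_ratio (R : realType) (X L : nat -> R) (kappa : R) :
  L n @[n --> \oo] --> +oo ->
  (forall e, 0 < e -> exists C, forall n, `|X n - kappa * L n| <= C + e * L n) ->
  X n / L n @[n --> \oo] --> kappa.
Proof.
move=> Loo XL; apply/cvgrPdist_le => eps eps_gt0.
have [C XC] := XL (eps / 2) (divr_gt0 eps_gt0 (ltr0n _ 2)).
near=> n.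
have L1 : 1 <= L n by near: n; exact: cvgry_ge.
(* Beyond this point [C + (eps / 2) L <= eps L]. *)
have LC : 2 * C / eps <= L n by near: n; exact: cvgry_ge.
have L0 : 0 < L n by apply: lt_le_trans L1.
have -> : kappa - X n / L n = - (X n - kappa * L n) / L n by field; rewrite gt_eqF.
rewrite normrM normrN normfV (gtr0_norm L0) ler_pdivrMr //.
apply: le_trans (XC n) _; move: LC; rewrite ler_pdivrMr //; lra.
Unshelve. all: by end_near.
Qed.

Theorem theorem6p2 (R : realType) (kappa : R) :
  0 <= kappa <= 4 ->
  exists (Hs : nat -> R) (Ns : nat -> nat),
    (forall n, Bset 2 4 (Hs n)) /\
    (forall n, alg_degree (complex.real_complex_def (Phant R) (Hs n ^+ 4)) 2) /\
    (forall n, (Aset 2 4 (Hs n) #= `I_(Ns n))%card) /\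
    (Hs n @[n --> \oo] --> +oo) /\
    ((ln (Ns n)%:R / ln (Hs n)) @[n --> \oo] --> kappa).
Proof.
(* The heights are fourth roots, so [theta * ln h] equals [4 * theta * ln H]. *)
move=> /andP[k0 k4]; set theta := kappa / 4.
have t01 : 0 <= theta <= 1 by rewrite /theta; apply/andP; split; lra.
have /choice [h hP] := fun n => exists_height_scale n t01.
have /choice [T TP] := hP.
have /choice [N NP] := TP.
have /choice [m mP] := NP.
have ln2 : 0 < ln (2 : R) by rewrite ln_gt0 // ltr1n.
have ln3 : 0 < ln (3 : R) by rewrite ln_gt0 // ltr1n.
pose Hs n := powR (h n) (4%:R)^-1.
have lnHs n : ln (Hs n) = ln (h n) / 4 by rewrite ln_powR mulrC.
set c := 3 * ln 2 + 2 * ln 3 in mP.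
have lnHs_lb n : n%:R * (ln 2 / 8) - c / 4 <= ln (Hs n).
  have [_ [Tn hT _ _ _]] := mP n.
  by rewrite lnHs; move: hT; rewrite ler_norml => /andP[? ?]; lra.
have lnHs_oo : ln (Hs n) @[n --> \oo] --> +oo.
  apply: (@ger_cvgy _ _ _ _ (fun n => n%:R * (ln 2 / 8) - c / 4)).
    exact: nearW.
  apply/cvgryPge => A; near=> n.
  have : (A + c / 4) / (ln 2 / 8) <= n%:R by near: n; exact: nbhs_infty_ger.
  by rewrite ler_pdivrMr ?divr_gt0 //; lra.
exists Hs, N; split; first by move=> n; have [[]] := mP n.
split.
  move=> n; have [[h1 _ hdeg _] _] := mP n.
  have h0 : 0 <= h n by apply: le_trans h1.
  by rewrite -powR_mulrn ?powR_ge0 // -powRrM mulVf ?pnatr_eq0 // powRr1.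
split; first by move=> n; have [[]] := mP n.
split.
  apply: (ger_cvgy _ lnHs_oo); apply: nearW => n.
  have [[h1 _ _ _] _] := mP n.
  by rewrite ltW // ln_sublinear // powR_gt0 // (lt_le_trans ltr01 h1).
apply: cvg_ratio lnHs_oo _ => e e_gt0.
(* With [1 / k <= e / 4], the bound [d(m)^k <= C m <= C h] gives
   [ln d(m) <= ln C + e (ln h) / 4]. *)
pose k := (Num.trunc (4 / e)).+1.
have k_gt0 : (0 < k)%N by [].
have ke : 4 <= k%:R * e.
  have /andP[_] := truncn_itv (divr_ge0 (ler0n R 4) (ltW e_gt0)).
  by rewrite ltr_pdivrMr // => /ltW.
have [C [C_gt0 CP]] := size_divisors_exp_le k_gt0.
exists (ln 1344 + 2 * ln 2 + c + ln C%:R) => n.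
have [[h1 _ _ _] [Tn hT Nlb Nub [m_gt0 mh]]] := mP n.
have lnC : 0 <= ln C%:R :> R by rewrite ln_ge0 // ler1n.
have ln1344 : 0 <= ln 1344%:R :> R by rewrite ln_ge0 // ler1n.
have lnh : 0 <= ln (h n) by rewrite ln_ge0.
have d_gt0 := size_divisors_gt0 (m n).
have kd : k%:R * ln (size (divisors (m n)))%:R <= ln C%:R + ln (h n).
  rewrite mulr_natl -lnXn ?ltr0n //.
  apply: (@le_trans _ _ (ln (C%:R * (m n)%:R))).
    by rewrite -natrX -natrM ln_le_homo ?ltr0n ?expn_gt0 ?d_gt0 // ler_nat CP.
  by rewrite lnM ?posrE ?ltr0n // lerD2l ln_le_homo ?ltr0n.
have k1 : 1 <= k%:R :> R by rewrite ler1n.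
have d_ub : ln (size (divisors (m n)))%:R <= ln C%:R + e * (ln (h n) / 4).
  rewrite -(@ler_pM2l _ k%:R) ?ltr0n //; apply: (le_trans kd).
  by nra.
have {}hT : `|theta * T n - theta * ln (h n)| <= c.
  rewrite -mulrBr normrM distrC ger0_norm; last by case/andP: t01.
  by apply: le_trans hT; rewrite ler_piMl //; case/andP: t01.
rewrite lnHs (_ : kappa * _ = theta * ln (h n)); last by rewrite /theta; field.
have eh : 0 <= e * (ln (h n) / 4) by rewrite mulr_ge0 ?divr_ge0 // ltW.
move: hT; rewrite !ler_norml => /andP[? ?]; apply/andP; split; lra.
Unshelve. all: by end_near.
Qed.
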